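(* There is an absolute constant $c>0$ such that the following holds. Let $f(\mathbf x)=\mathbb E_{\psi\sim\mathcal D}[\psi(\mathbf x)]$ satisfy the convexity/smoothness assumption stated in the context, with strong convexity constant $\mu$, component smoothness constant $\lambda$, and $\kappa=\lambda/\mu$, and let $\mathbf x^*$ be its minimizer. Suppose moreover that either (a) $f$ has a Lipschitz continuous Hessian, or (b) $f$ is self-concordant. Let $\alpha\ge 1$, $\delta\in(0,1)$, let $t\ge 1$ be an integer, and suppose that $\tilde{\mathbf x}_s\in U_f(1/(c\alpha))$ and that we are given the gradient $\tilde{\mathbf g}_s=\nabla f(\tilde{\mathbf x}_s)$ and a symmetric matrix $\tilde{\mathbf H}\in\mathbb R^{d\times d}$ with $$\frac1{\sqrt\alpha}\nabla^2 f(\tilde{\mathbf x}_s)\preceq\tilde{\mathbf H}\preceq\sqrt\alpha\,\nabla^2 f(\tilde{\mathbf x}_s).$$ Let $\mathbf x_0=\tilde{\mathbf x}_s$ and, for each inner iteration $j=0,1,\dots,t-1$, let $$\mathbf x_{j+1}=\mathbf x_j-\eta\tilde{\mathbf H}^{-1}\Big(\frac1m\sum_{i=1}^m\big(\nabla\psi_i(\mathbf x_j)-\nabla\psi_i(\tilde{\mathbf x}_s)\big)+\tilde{\mathbf g}_s\Big),$$ where in each iteration $\psi_1,\dots,\psi_m$ is a fresh i.i.d. sample from $\mathcal D$, the mini-batch size satisfies $m\ge c\,\alpha^2\kappa\log(t/\delta)$, and the step size is $\eta=\min\{\sqrt{2/\alpha},1\}$. Then the iterate $\tilde{\mathbf x}_{s+1}=\mathbf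 x_t$ satisfies, with probability at least $1-\delta$, $$\frac{f(\tilde{\mathbf x}_{s+1})-f(\mathbf x^* )}{f(\tilde{\mathbf x}_s)-f(\mathbf x^* )}\le\Big(1-\frac1{2\alpha}\Big)^t+c\,\alpha^2\log(t/\delta)\,\frac{\kappa}{m}.$$
   Context: Setting: $\mathcal D$ is a distribution over convex functions $\psi:\mathbb R^d\to\mathbb R$ and $f(\mathbf x)=\mathbb E_{\psi\sim\mathcal D}[\psi(\mathbf x)]$ (this includes finite sums $f=\frac1n\sum_{i=1}^n\psi_i$, by taking $\mathcal D$ uniform on $\{\psi_1,\dots,\psi_n\}$). Convexity/smoothness assumption: $f$ has continuous first and second derivatives; $f$ is $\mu$-strongly convex with $\mu>0$, i.e. $f(\mathbf x)\ge f(\mathbf x')+\nabla f(\mathbf x')^\top(\mathbf x-\mathbf x')+\frac\mu2\|\mathbf x-\mathbf x'\|^2$ for all $\mathbf x,\mathbf x'$; and every component $\psi$ in the support of $\mathcal D$ is $\lambda$-smooth, i.e. differentiable with $\psi(\mathbf x)\le\psi(\mathbf x')+\nabla\psi(\mathbf x')^\top(\mathbf x-\mathbf x')+\frac\lambda2\|\mathbf x-\mathbf x'\|^2$ for all $\mathbf x,\mathbf x'$. The condition number is $\kappa=\lambda/\mu$. Lipschitz Hessian with constant $L>0$: $\|\nabla^2f(\mathbf x)-\nabla^2f(\mathbf x')\|\le L\|\mathbf x-\mathbf x'\|$ for all $\mathbf x,\mathbf x'$. Self-concordance: for all $\mathbf x,\mathbf x'\in\mathbb R^d$ the function $\phi(\tau)=f(\mathbf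 x+\tau\mathbf x')$ satisfies $|\phi'''(\tau)|\le2(\phi''(\tau))^{3/2}$. Notation: $\|\mathbf v\|_{\mathbf M}=\sqrt{\mathbf v^\top\mathbf M\mathbf v}$; $\preceq$ is the positive semidefinite order. Local neighborhood for $\epsilon\in(0,1)$: if $f$ has an $L$-Lipschitz Hessian, $U_f(\epsilon)=\{\mathbf x:\|\mathbf x-\mathbf x^*\|_{\nabla^2f(\mathbf x^* )}<\epsilon\,\mu^{3/2}/L\}$; if $f$ is self-concordant, $U_f(\epsilon)=\{\mathbf x:\|\mathbf x-\mathbf x^*\|_{\nabla^2f(\mathbf x^* )}<\epsilon/4\}$. *)

(* Defs.v *)
From HB Require Import structures.
From mathcomp Require Import all_boot all_order all_algebra.
From mathcomp Require Import all_classical all_reals all_analysis.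

Set Implicit Arguments.
Unset Strict Implicit.
Unset Printing Implicit Defensive.
Import Order.TTheory GRing.Theory Num.Theory.
Import numFieldNormedType.Exports.
Local Open Scope classical_set_scope.
Local Open Scope ring_scope.

(* The library norm on 'cV[R]_d is the sup norm, so Euclidean notions are
   defined here; both norms induce the same topology, hence the same notions of
   differentiability and continuity. *)
Definition dot (R : realType) (d : nat) (u v : 'cV[R]_d) : R :=
  (u^T *m v) 0 0.

Definition l2norm (R : realType) (d : nat) (v : 'cV[R]_d) : R :=
  Num.sqrt (dot v v).

Definition wnorm (R : realType) (d : nat) (M : 'M[R]_d) (v : 'cV[R]_d) : R :=
  Num.sqrt (dot v (M *m v)).

(* Spectral norm: the operator norm induced by l2norm. *)
Definition opnorm (R : realType) (d : nat) (M : 'M[R]_d) : R :=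
  sup [set l2norm (M *m v) | v in [set v : 'cV[R]_d | l2norm v <= 1]].

Definition psd (R : realType) (d : nat) (M : 'M[R]_d) : Prop :=
  M^T = M /\ forall v : 'cV[R]_d, 0 <= dot v (M *m v).

Definition loewner_le (R : realType) (d : nat) (A B : 'M[R]_d) : Prop :=
  psd (B - A).

Definition gradient (R : realType) (d : nat) (f : 'cV[R]_d -> R)
    (x : 'cV[R]_d) : 'cV[R]_d :=
  \col_i 'D_(delta_mx i 0) f x.

Definition hessian (R : realType) (d : nat) (f : 'cV[R]_d -> R)
    (x : 'cV[R]_d) : 'M[R]_d :=
  \matrix_(i, j) 'D_(delta_mx j 0) (fun y => gradient f y i 0) x.

Definition C2 (R : realType) (d : nat) (f : 'cV[R]_d -> R) : Prop :=
  [/\ forall x, differentiable f x, continuous (gradient f),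
      forall x, differentiable (gradient f) x & continuous (hessian f)].

Definition strongly_convex (R : realType) (d : nat) (mu : R)
    (f : 'cV[R]_d -> R) : Prop :=
  forall x x' : 'cV[R]_d,
    f x >= f x' + dot (gradient f x') (x - x') + mu / 2 * l2norm (x - x') ^+ 2.

Definition smooth (R : realType) (d : nat) (lambda : R)
    (psi : 'cV[R]_d -> R) : Prop :=
  (forall x, differentiable psi x) /\
  forall x x' : 'cV[R]_d,
    psi x <= psi x' + dot (gradient psi x') (x - x')
             + lambda / 2 * l2norm (x - x') ^+ 2.

Definition lipschitz_hessian (R : realType) (d : nat) (L : R)
    (f : 'cV[R]_d -> R) : Prop :=
  forall x x' : 'cV[R]_d,
    opnorm (hessian f x - hessian f x') <= L * l2norm (x - x').

(* The derivability clause is what gives the third iterated derivative its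
   meaning: the existence of the third derivative is part of the property. *)
Definition self_concordant (R : realType) (d : nat) (f : 'cV[R]_d -> R) : Prop :=
  forall x x' : 'cV[R]_d, let phi : R -> R := fun tau => f (x + tau *: x') in
    (forall k (tau : R), (k < 3)%N -> derivable (derive1n k phi) tau 1) /\
    forall tau : R, `|derive1n 3 phi tau| <= 2 * (derive1n 2 phi tau) `^ (3 / 2).

Definition minimizer (R : realType) (d : nat) (f : 'cV[R]_d -> R)
    (xs : 'cV[R]_d) : Prop :=
  forall x, f xs <= f x.

Definition nbhd_lipschitz (R : realType) (d : nat) (f : 'cV[R]_d -> R)
    (mu L : R) (xs : 'cV[R]_d) (eps : R) : set 'cV[R]_d :=
  [set x | wnorm (hessian f xs) (x - xs) < eps * (mu `^ (3 / 2) / L)].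

Definition nbhd_self_concordant (R : realType) (d : nat) (f : 'cV[R]_d -> R)
    (xs : 'cV[R]_d) (eps : R) : set 'cV[R]_d :=
  [set x | wnorm (hessian f xs) (x - xs) < eps / 4].

Definition mutually_independent (R : realType) (dO dT : measure_display)
    (Omega : measurableType dO) (T : measurableType dT)
    (P : probability Omega R) (I : finType) (X : I -> {RV P >-> T}) : Prop :=
  forall (J : {set I}) (A : I -> set T), (forall i, measurable (A i)) ->
    P (\bigcap_(i in [set` J]) (X i @^-1` A i))
    = (\prod_(i in J) P (X i @^-1` A i))%E.

Definition iid (R : realType) (dO dT : measure_display)
    (Omega : measurableType dO) (T : measurableType dT)
    (P : probability Omega R) (D : probability T R)
    (I : finType) (X : I -> {RV P >-> T}) : Prop :=
  mutually_independent X /\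
  forall i (A : set T), measurable A -> distribution P (X i) A = D A.

(* Main.v *)
(* Let A be the Hessian at the snapshot. Near the minimizer every Hessian is within a
   factor 1 +- O(1/alpha) of A, so the gradient is A (x - x* ) up to a small error in
   the norms of A, and polarization turns the sandwich of H between A / sqrt alpha
   and sqrt alpha A into a contraction of one noiseless step by 1 - 1/alpha in the
   A-norm. In the self-concordant case, where mixed third derivatives are not
   assumed to exist, Hessians are compared through second differences of f.

   Co-coercivity of the component gradients bounds the variance of a variance-reduced
   gradient by O(lambda) times a Bregman divergence of f, whence a condition number
   and not its square. Conditionally on the past, a Bernstein inequality for sums of
   vectors (Pinelis: cosh of the norm of the partial sums) bounds the noise of a
   mini-batch, except on an event of probability delta / t. The noise of the first
   step vanishes, so this is needed only for t >= 2, where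
   2 (delta / t)^2 <= delta / t. Outside the union of these events the squared
   A-distance E satisfies E' <= (1 - 7 / (8 alpha)) E + O(alpha kappa log(t / delta) / m) E_0;
   the gap between 7/8 and 1/2 absorbs the factor 1 + O(1/alpha) lost between E and
   the values of f. *)

Require Import Defs.
From HB Require Import structures.
From mathcomp Require Import all_boot all_order all_algebra.
From mathcomp Require Import all_classical all_reals all_analysis.
From mathcomp Require Import measurable_realfun simple_functions.
From mathcomp Require Import ring lra.
Import Order.TTheory GRing.Theory Num.Theory.
Import numFieldNormedType.Exports.
Local Open Scope classical_set_scope.
Local Open Scope ring_scope.
Set Implicit Arguments.
Unset Strict Implicit.
Unset Printing Implicit Defensive.

(** * Weighted norms and the preconditioned step *)

(** The obstacle is circular: the Hessian comparison and the variance bound hold only in the ball of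
    points no farther from the minimizer than the snapshot, and an iterate stays there only if the
    noise was small. No stopping time is introduced. A step counts as bad only if its iterate lies
    in the ball and its noise is large; off the bad events a deterministic induction carries
    membership in the ball along with the error bound.

    Measuring the ball in the norm of [A], rather than of the Hessian at the minimizer, makes the
    contraction exact, since the preconditioner is compared with [A]; the price is a change of
    center in the Hessian comparison.

    The cosh argument loses no factor of the dimension, unlike a scalar inequality for each
    coordinate. It needs small samples as well as small variance. The worst-case size of a sample
    involves the square of [lambda] over [mu], but only through [l * lambda / (m * mu)], which the
    batch size makes small, so the final bound sees the variance alone.

    Conditioning on the past is done by Tonelli: the past is a sigma-algebra on [Omega], and a fresh
    sample is integrated out with the past frozen. *)

Section Dot.
Context {R : realType} {d : nat}.
Implicit Types (u v w : 'cV[R]_d) (A M N : 'M[R]_d) (a b c p q r s : R).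

Lemma dotE u v : dot u v = \sum_i u i 0 * v i 0.
Proof. by rewrite /dot mxE; apply: eq_bigr => i _; rewrite mxE. Qed.

Lemma dotC u v : dot u v = dot v u.
Proof. by rewrite !dotE; apply: eq_bigr => i _; rewrite mulrC. Qed.

Lemma dotDl u v w : dot (u + v) w = dot u w + dot v w.
Proof. by rewrite /dot linearD mulmxDl mxE. Qed.

Lemma dotZl a u v : dot (a *: u) v = a * dot u v.
Proof. by rewrite /dot linearZ -scalemxAl mxE. Qed.

Lemma dotNl u v : dot (- u) v = - dot u v.
Proof. by rewrite -scaleN1r dotZl mulN1r. Qed.

Lemma dotBl u v w : dot (u - v) w = dot u w - dot v w.
Proof. by rewrite dotDl dotNl. Qed.

Lemma dotDr u v w : dot u (v + w) = dot u v + dot u w.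
Proof. by rewrite dotC dotDl !(dotC u). Qed.

Lemma dotZr a u v : dot u (a *: v) = a * dot u v.
Proof. by rewrite dotC dotZl dotC. Qed.

Lemma dotNr u v : dot u (- v) = - dot u v.
Proof. by rewrite dotC dotNl dotC. Qed.

Lemma dotBr u v w : dot u (v - w) = dot u v - dot u w.
Proof. by rewrite dotDr dotNr. Qed.

Lemma dot0l u : dot 0 u = 0.
Proof. by rewrite -(scale0r 0) dotZl mul0r. Qed.

Lemma dot0r u : dot u 0 = 0.
Proof. by rewrite dotC dot0l. Qed.

Lemma dot_delta_mx u i : dot u (delta_mx i 0) = u i 0.
Proof.
rewrite dotE (bigD1 i) //= mxE !eqxx mulr1 big1 ?addr0 // => j ji.
by rewrite mxE (negbTE ji) mulr0.
Qed.

Lemma dot_ge0 u : 0 <= dot u u.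
Proof. by rewrite dotE; apply: sumr_ge0 => i _; rewrite -expr2 sqr_ge0. Qed.

Lemma dot_eq0 u : dot u u = 0 -> u = 0.
Proof.
rewrite dotE => /eqP; rewrite psumr_eq0; last first.
  by move=> i _; rewrite -expr2 sqr_ge0.
move=> /allP u0; apply/matrixP => i j; rewrite ord1 mxE.
have /implyP := u0 i (mem_index_enum i).
by move=> /(_ isT); rewrite mulf_eq0 orbb => /eqP.
Qed.

Lemma dot_quad0 M u : u = 0 -> dot u (M *m u) = 0.
Proof. by move->; rewrite dot0l. Qed.

Lemma dot_mulmx_tr u M v : dot u (M *m v) = dot (M^T *m u) v.
Proof. by rewrite /dot trmx_mul trmxK mulmxA. Qed.

Lemma dot_sym M u v : M^T = M -> dot u (M *m v) = dot v (M *m u).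
Proof. by move=> Ms; rewrite dot_mulmx_tr Ms dotC. Qed.

(** A quadratic in [s] without negative values has nonpositive discriminant. Its minimizer [c / q]
    is the test point; for [q = 0] the expression is affine and a large [s] forces [c = 0]. *)
Lemma sqr_le_of_affine c p q : 0 <= p -> 0 <= q ->
  (forall s, 2 * s * c <= p + s ^+ 2 * q) -> c ^+ 2 <= p * q.
Proof.
move=> p0 q0 H; have [q_eq0|qn0] := eqVneq q 0.
  have [->|cn0] := eqVneq c 0; first by rewrite expr0n q_eq0 mulr0.
  have := H ((p + 1) / (2 * c)).
  have -> : 2 * ((p + 1) / (2 * c)) * c = p + 1 by field.
  by rewrite q_eq0 !mulr0 => ?; lra.
have qp : 0 < q by rewrite lt0r qn0.
have := H (c / q).
have -> : 2 * (c / q) * c = 2 * (c ^+ 2 / q) by field.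
have -> : (c / q) ^+ 2 * q = c ^+ 2 / q by field.
by move=> h; rewrite -ler_pdivrMr //; lra.
Qed.

(* Polarization: the values of a symmetric form on the diagonal control it off
   the diagonal, with the same constant. *)
Lemma sym_form_bound A M r u v : M^T = M -> A^T = A ->
  (forall w, 0 <= dot w (A *m w)) ->
  (forall w, `|dot w (M *m w)| <= r * dot w (A *m w)) ->
  dot u (M *m v) ^+ 2 <= r ^+ 2 * (dot u (A *m u) * dot v (A *m v)).
Proof.
move=> Ms As A0 H.
rewrite [leRHS](_ : _ = (r * dot u (A *m u)) * (r * dot v (A *m v))); last by ring.
have rA w : 0 <= r * dot w (A *m w) by apply: le_trans (H w).
apply: sqr_le_of_affine => // s.
have /ler_normlP[_ h1] := H (u + s *: v); have /ler_normlP[h2 _] := H (u - s *: v).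
move: h1 h2; rewrite !mulmxDr !mulmxN -!scalemxAr !(dotDl, dotDr, dotNl, dotNr, dotZl, dotZr).
rewrite (dot_sym v u Ms) (dot_sym v u As) => h1 h2.
by lra.
Qed.

Lemma psd_cauchy_schwarz A u v : psd A ->
  dot u (A *m v) ^+ 2 <= dot u (A *m u) * dot v (A *m v).
Proof.
move=> [As A0]; have := @sym_form_bound A A 1 u v As As A0.
by rewrite expr1n mul1r; apply => w; rewrite mul1r ger0_norm.
Qed.

Lemma sub_sym M N : M^T = M -> N^T = N -> (M - N)^T = M - N.
Proof. by move=> Ms Ns; rewrite linearB /= Ms Ns. Qed.

Lemma psd1 : psd (1%:M : 'M[R]_d).
Proof. by split=> [|v]; rewrite ?trmx1 // mul1mx dot_ge0. Qed.

Lemma l2normE v : l2norm v = wnorm 1%:M v.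
Proof. by rewrite /l2norm /wnorm mul1mx. Qed.

Lemma wnorm_ge0 A v : 0 <= wnorm A v.
Proof. exact: sqrtr_ge0. Qed.

Lemma l2norm_ge0 v : 0 <= l2norm v.
Proof. exact: sqrtr_ge0. Qed.

Lemma wnorm_sqr A v : psd A -> wnorm A v ^+ 2 = dot v (A *m v).
Proof. by move=> [_ A0]; rewrite sqr_sqrtr. Qed.

Lemma l2norm_sqr v : l2norm v ^+ 2 = dot v v.
Proof. by rewrite sqr_sqrtr // dot_ge0. Qed.

Lemma ler_norm_of_sqr a b : 0 <= b -> a ^+ 2 <= b ^+ 2 -> `|a| <= b.
Proof.
by move=> b0 h; rewrite -(ger0_norm b0) -ler_sqr ?nnegrE // !real_normK ?num_real.
Qed.

Lemma norm_dot_wnorm A u v : psd A -> `|dot u (A *m v)| <= wnorm A u * wnorm A v.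
Proof.
move=> pA; apply: ler_norm_of_sqr; first by rewrite mulr_ge0 ?wnorm_ge0.
by rewrite exprMn !wnorm_sqr // psd_cauchy_schwarz.
Qed.

Lemma norm_dot u v : `|dot u v| <= l2norm u * l2norm v.
Proof. by rewrite !l2normE -{1}(mul1mx v) norm_dot_wnorm //; exact: psd1. Qed.

Lemma wnormZ A a v : wnorm A (a *: v) = `|a| * wnorm A v.
Proof.
rewrite /wnorm -scalemxAr dotZl dotZr mulrA -expr2 sqrtrM ?sqr_ge0 //.
by rewrite sqrtr_sqr.
Qed.

Lemma wnormN A v : wnorm A (- v) = wnorm A v.
Proof. by rewrite -scaleN1r wnormZ normrN1 mul1r. Qed.

Lemma wnormD A u v : psd A -> wnorm A (u + v) <= wnorm A u + wnorm A v.
Proof.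
move=> pA; rewrite -[leLHS](ger0_norm (wnorm_ge0 _ _)).
apply: ler_norm_of_sqr; first by rewrite addr_ge0 ?wnorm_ge0.
rewrite wnorm_sqr // mulmxDr !(dotDl, dotDr) (dot_sym v u (proj1 pA)).
rewrite sqrrD !wnorm_sqr //.
have := le_trans (ler_norm _) (norm_dot_wnorm u v pA).
by rewrite mulr2n; lra.
Qed.

Lemma wnormB A u v : psd A -> wnorm A (u - v) <= wnorm A u + wnorm A v.
Proof. by move=> pA; rewrite (le_trans (wnormD _ _ pA)) // wnormN. Qed.

Lemma wnorm0 A : wnorm A 0 = 0.
Proof. by rewrite /wnorm dot0l sqrtr0. Qed.

Lemma l2norm0 : l2norm (0 : 'cV[R]_d) = 0.
Proof. by rewrite l2normE wnorm0. Qed.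

Lemma l2normZ a v : l2norm (a *: v) = `|a| * l2norm v.
Proof. by rewrite !l2normE wnormZ. Qed.

Lemma l2normN v : l2norm (- v) = l2norm v.
Proof. by rewrite !l2normE wnormN. Qed.

Lemma l2normD u v : l2norm (u + v) <= l2norm u + l2norm v.
Proof. by rewrite !l2normE; apply: wnormD; exact: psd1. Qed.

Lemma l2norm_eq0 v : l2norm v = 0 -> v = 0.
Proof. by move=> v0; apply: dot_eq0; rewrite -l2norm_sqr v0 expr0n. Qed.

Lemma wnorm_gt0 A v : 0 < dot v (A *m v) -> 0 < wnorm A v.
Proof. by rewrite sqrtr_gt0. Qed.

Lemma sqrt_l2norm_le_wnorm A b v : 0 <= b -> b * dot v v <= dot v (A *m v) ->
  Num.sqrt b * l2norm v <= wnorm A v.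
Proof. by move=> b0 h; rewrite -sqrtrM // ler_wsqrtr. Qed.

Lemma wnorm_leP A v a : psd A -> 0 <= a ->
  wnorm A v <= a <-> dot v (A *m v) <= a ^+ 2.
Proof.
move=> pA a0; rewrite -wnorm_sqr // ler_sqr ?nnegrE ?wnorm_ge0 //.
Qed.

Lemma wnorm_le_dot A u v : psd A -> wnorm A u <= wnorm A v ->
  dot u (A *m u) <= dot v (A *m v).
Proof. by move=> pA h; rewrite -(wnorm_sqr v pA); apply/wnorm_leP => //; exact: wnorm_ge0. Qed.

Lemma mulmx_coord M v i : (M *m v) i 0 = dot (row i M)^T v.
Proof. by rewrite /dot trmxK -row_mul [in RHS]mxE. Qed.

End Dot.

Section Step.
Context {R : realType} {d : nat}.
Implicit Types (u v w g xi : 'cV[R]_d) (A H M : 'M[R]_d) (mu alpha eta rho theta : R).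

Lemma unitmx_of_inj M : (forall v, M *m v = 0 -> v = 0) -> M \in unitmx.
Proof.
move=> inj; rewrite -unitmx_tr -row_free_unit -kermx_eq0.
apply/rowV0P => v /sub_kermxP vM.
apply: (can_inj trmxK); rewrite trmx0; apply: inj.
by rewrite -[M]trmxK -trmx_mul vM trmx0.
Qed.

Lemma loewner_leP A B v : loewner_le A B -> dot v (A *m v) <= dot v (B *m v).
Proof. by move=> [_ /(_ v)]; rewrite mulmxBl dotBr subr_ge0. Qed.

(** The eigenvalues of the inverse of [H] times [A] lie between [1 / sqrt alpha] and [sqrt alpha];
    the last two bounds place [eta] times them between [1 / alpha] and [2 - 1 / alpha]. The bound by
    3/2, in fact by the root of 2, controls how a step amplifies errors in the gradient. *)
Lemma step_size alpha (eta := Num.min (Num.sqrt (2 / alpha)) 1) : 1 <= alpha ->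
  [/\ 0 <= eta, eta * Num.sqrt alpha <= 3 / 2,
      1 / alpha <= eta / Num.sqrt alpha &
      eta * Num.sqrt alpha <= 2 - 1 / alpha].
Proof.
move=> a1; rewrite /eta {eta}.
set r := Num.sqrt alpha.
have a0 : 0 < alpha by lra.
have r0 : 0 < r by rewrite sqrtr_gt0.
have ra : r ^+ 2 = alpha by rewrite sqr_sqrtr // ltW.
rewrite sqrtrM ?ler0n // (sqrtrV (ltW a0)) -/r.
set s := Num.sqrt 2.
have s0 : 0 < s by rewrite sqrtr_gt0.
have s2 : s ^+ 2 = 2 by rewrite sqr_sqrtr.
have s32 : s <= 3 / 2 by nra.
have s1 : 1 <= s by nra.
have r1 : 1 <= r by nra.
rewrite -!ra.
have [h|h] := leP (s / r) 1.
  have sr : s <= r by rewrite ler_pdivrMr // mul1r in h.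
  have i : 1 / r ^+ 2 <= 1 / 2.
    rewrite !mul1r lef_pV2 ?posrE ?exprn_gt0 // -s2.
    by rewrite ler_sqr // nnegrE ltW.
  split.
  - by rewrite divr_ge0 ?ltW.
  - by rewrite mulfVK ?gt_eqF.
  - by rewrite -mulrA -invfM -expr2 ler_pM2r // invr_gt0 exprn_gt0.
  - by rewrite mulfVK ?gt_eqF //; lra.
have rs : r < s by rewrite ltr_pdivlMr // mul1r in h.
split.
- by [].
- by lra.
- by rewrite !mul1r lef_pV2 ?posrE ?exprn_gt0 //; nra.
(* Here [eta = 1], and the claim is that the cubic r^3 - 2 r^2 + 1 = (r - 1)(r^2 - r - 1) is
   nonpositive. This holds from 1 up to the golden ratio, which exceeds the root of 2. *)
- have -> : 2 - 1 / r ^+ 2 = (2 * r ^+ 2 - 1) / r ^+ 2 by field; rewrite gt_eqF.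
  rewrite ler_pdivlMr ?exprn_gt0 //.
  have : (r - 1) * (3 / 2 - r) >= 0 by apply: mulr_ge0; lra.
  by nra.
Qed.

Section Preconditioner.
Variables (A H : 'M[R]_d) (mu alpha : R).
Hypotheses (mu0 : 0 < mu) (alpha1 : 1 <= alpha) (As : A^T = A) (Hs : H^T = H).
Hypothesis Amu : forall v, mu * dot v v <= dot v (A *m v).
Hypothesis AH : loewner_le ((1 / Num.sqrt alpha) *: A) H.
Hypothesis HA : loewner_le H (Num.sqrt alpha *: A).

Let r := Num.sqrt alpha.

Let r_gt0 : 0 < r. Proof. by rewrite sqrtr_gt0; exact: lt_le_trans ltr01 alpha1. Qed.

Lemma pd_psd : psd A.
Proof. by split=> // v; apply: le_trans (Amu v); rewrite mulr_ge0 ?dot_ge0 ?ltW. Qed.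

Let AHq v : dot v (A *m v) <= r * dot v (H *m v).
Proof.
have := loewner_leP v AH; rewrite -scalemxAl dotZr mul1r => h.
by rewrite -ler_pdivrMl // mulrC in h *; rewrite mulrC.
Qed.

Let HAq v : dot v (H *m v) <= r * dot v (A *m v).
Proof. by have := loewner_leP v HA; rewrite -scalemxAl dotZr. Qed.

Let psdA := pd_psd.

Let psdH : psd H.
Proof.
split=> // v; have := AHq v; have := proj2 psdA v => h1 h2.
by rewrite -(pmulr_rge0 _ r_gt0); exact: le_trans h2.
Qed.

Lemma precond_unit : H \in unitmx.
Proof.
apply: unitmx_of_inj => v Hv; apply: dot_eq0; apply/eqP.
have := AHq v; rewrite Hv dot0r mulr0 => h.
rewrite eq_le dot_ge0 andbT -(pmulr_rle0 _ mu0).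
exact: le_trans (Amu v) h.
Qed.

(** The hypothesis bounds the dual [A]-norm of [xi]. Testing it at the solution [y] itself gives
    |y|^2 <= r (y . xi) <= r b |y| in the [A]-norm. *)
Lemma precond_solve_wnorm xi b : 0 <= b ->
  (forall y, `|dot y xi| <= b * wnorm A y) ->
  wnorm A (invmx H *m xi) <= Num.sqrt alpha * b.
Proof.
move=> b0 hb; set y := invmx H *m xi.
have Hy : H *m y = xi by rewrite /y mulmxA mulmxV ?mul1mx // precond_unit.
have := AHq y; rewrite Hy -wnorm_sqr // => h.
have := le_trans (ler_norm _) (hb y) => h'.
have n0 := wnorm_ge0 A y.
have [->|yn0] := eqVneq (wnorm A y) 0; first by rewrite mulr_ge0 // ltW.
have yp : 0 < wnorm A y by rewrite lt0r yn0.
by rewrite -(ler_pM2r yp) -expr2 (le_trans h) // -mulrA ler_pM2l.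
Qed.

(** The step operator is self-adjoint for the inner product of [A], so its norm is governed by the
    quadratic form of [M], which is [A] times that operator. This replaces a simultaneous
    diagonalization of [A] and [H]. *)
Lemma precond_contract eta rho w : 0 <= eta -> 0 <= rho ->
  1 - rho <= eta / r -> eta * r <= 1 + rho ->
  wnorm A (w - eta *: (invmx H *m (A *m w))) <= rho * wnorm A w.
Proof.
move=> eta0 rho0 h1 h2.
pose M := A - eta *: (A *m invmx H *m A).
have Ms : M^T = M.
  by rewrite /M linearB /= linearZ /= !trmx_mul As trmx_inv Hs mulmxA.
have bound v : `|dot v (M *m v)| <= rho * dot v (A *m v).
  pose y := invmx H *m (A *m v).
  have Hy : H *m y = A *m v by rewrite /y mulmxA mulmxV ?mul1mx // precond_unit.
  have -> : dot v (M *m v) = dot v (A *m v) - eta * dot y (H *m y).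
    rewrite /M mulmxBl dotBr -scalemxAl dotZr -!mulmxA -/y Hy.
    by rewrite (dot_sym _ _ As).
  set s := dot y (H *m y); set a := dot v (A *m v).
  have s0 : 0 <= s by apply: (proj2 psdH).
  have a0 : 0 <= a by apply: (proj2 psdA).
  (* The sandwich is inverted by Cauchy-Schwarz instead of matrix square roots: in the form of [H]
     it gives a^2 <= (v . H v) s, in the form of [A] it gives s^2 <= a (y . A y). *)
  have ars : a <= r * s.
    have := psd_cauchy_schwarz v y psdH; rewrite -/s Hy -/a => h.
    have {}h : a ^+ 2 <= r * a * s by rewrite (le_trans h) // ler_wpM2r // HAq.
    have [->|an0] := eqVneq a 0; first by rewrite mulr_ge0 // ltW.
    have ap : 0 < a by rewrite lt0r an0.
    by rewrite -(ler_pM2r ap) -expr2 (le_trans h) // mulrAC.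
  have sra : s <= r * a.
    have := psd_cauchy_schwarz v y psdA; rewrite -/a (dot_sym _ _ As) -Hy -/s => h.
    have {}h : s ^+ 2 <= a * (r * s) by rewrite (le_trans h) // ler_wpM2l // AHq.
    have [->|sn0] := eqVneq s 0; first by rewrite mulr_ge0 // ltW.
    have sp : 0 < s by rewrite lt0r sn0.
    by rewrite -(ler_pM2r sp) -expr2 (le_trans h) // mulrA (mulrC a).
  rewrite ler_norml; apply/andP; split.
    have : eta * s <= (eta * r) * a by rewrite -mulrA ler_wpM2l.
    have : (eta * r) * a <= (1 + rho) * a by rewrite ler_wpM2r.
    by lra.
  have : (1 - rho) * a <= eta / r * a by rewrite ler_wpM2r.
  have : eta / r * a <= eta / r * (r * s) by rewrite ler_wpM2l // divr_ge0 // ltW.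
  have -> : eta / r * (r * s) = eta * s by field; rewrite gt_eqF.
  by lra.
set u := w - _.
have Au : A *m u = M *m w.
  by rewrite /u /M mulmxBl mulmxBr -scalemxAr -scalemxAl !mulmxA.
(* As [A u = M w], the off-diagonal value at [u] and [w] is the squared [A]-norm of [u]; dividing by
   that norm squared leaves the contraction. *)
have := sym_form_bound u w Ms As (proj2 psdA) bound.
rewrite -Au -!wnorm_sqr // => h.
have n0 := wnorm_ge0 A u; have m0 := wnorm_ge0 A w.
have [->|un0] := eqVneq (wnorm A u) 0; first by rewrite mulr_ge0.
have up : 0 < wnorm A u by rewrite lt0r un0.
rewrite -ler_sqr ?nnegrE ?mulr_ge0 // -(ler_pM2l (exprn_gt0 2 up)).
by rewrite -expr2 (le_trans h) // exprMn; lra.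
Qed.

(** The true gradient is split into its linear model [A D] and an error. Strong convexity turns the
    Euclidean norm of the noise into a dual [A]-norm at the cost of [sqrt mu]. *)
Lemma precond_step theta D g xi (eta := Num.min (Num.sqrt (2 / alpha)) 1) :
  0 <= theta ->
  (forall u, `|dot u (g - A *m D)| <= theta * wnorm A D * wnorm A u) ->
  wnorm A (D - eta *: (invmx H *m (xi + g))) <=
    (1 - 1 / alpha + 3 / 2 * theta) * wnorm A D
    + 3 / 2 * (l2norm xi / Num.sqrt mu).
Proof.
move=> theta0 hg; have [e0 e1 e2 e3] := step_size alpha1.
rewrite -/eta -/r in e0 e1 e2 e3.
have smu0 : 0 < Num.sqrt mu by rewrite sqrtr_gt0.
have -> : D - eta *: (invmx H *m (xi + g)) = (D - eta *: (invmx H *m (A *m D)))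
    - eta *: (invmx H *m xi) - eta *: (invmx H *m (g - A *m D)).
  by rewrite !mulmxDr !scalerDr mulmxN scalerN opprB (addrAC D) addrA subrK opprD addrA.
rewrite (le_trans (wnormB _ _ psdA)) //.
have Hg : wnorm A (eta *: (invmx H *m (g - A *m D))) <= 3 / 2 * theta * wnorm A D.
  rewrite wnormZ ger0_norm //.
  have := precond_solve_wnorm (mulr_ge0 theta0 (wnorm_ge0 _ _)) hg => h.
  apply: le_trans (ler_wpM2l e0 h) _.
  by rewrite mulrA -(mulrA (3 / 2)) ler_wpM2r // mulr_ge0 ?wnorm_ge0.
have Hxi : wnorm A (eta *: (invmx H *m xi)) <= 3 / 2 * (l2norm xi / Num.sqrt mu).
  rewrite wnormZ ger0_norm //.
  have h y : `|dot y xi| <= l2norm xi / Num.sqrt mu * wnorm A y.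
    rewrite (le_trans (norm_dot _ _)) // mulrC -mulrA ler_wpM2l ?l2norm_ge0 //.
    rewrite ler_pdivlMl // -sqrtrM ?(ltW mu0) // ler_wsqrtr //.
  have := precond_solve_wnorm (divr_ge0 (l2norm_ge0 xi) (ltW smu0)) h => {}h.
  apply: le_trans (ler_wpM2l e0 h) _.
  by rewrite mulrA ler_wpM2r // divr_ge0 ?l2norm_ge0 ?ltW.
have a0 : 0 < alpha := lt_le_trans ltr01 alpha1.
have Hc := @precond_contract eta (1 - 1 / alpha) D e0.
have -> : (1 - 1 / alpha + 3 / 2 * theta) * wnorm A D
    + 3 / 2 * (l2norm xi / Num.sqrt mu) = (1 - 1 / alpha) * wnorm A D +
    3 / 2 * (l2norm xi / Num.sqrt mu) + 3 / 2 * theta * wnorm A D by ring.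
apply: lerD => //; apply: (le_trans (wnormB _ _ psdA)); apply: lerD => //.
apply: Hc; last by lra.
  by rewrite subr_ge0 ler_pdivrMr // mul1r.
by rewrite /r; lra.
Qed.

End Preconditioner.
End Step.

(** * Second-order calculus and Hessian stability *)

Section Calculus.
Context {R : realType} {d : nat}.
Implicit Types (u v w x y : 'cV[R]_d) (f : 'cV[R]_d -> R) (a b s t tau : R).

Lemma derive_gradient f x v : differentiable f x ->
  'D_v f x = dot (gradient f x) v.
Proof.
move=> df; rewrite deriveE //.
have {1}-> : v = \sum_i v i 0 *: delta_mx i 0.
  apply/matrixP => i j; rewrite ord1 summxE (bigD1 i) //= !mxE !eqxx mulr1.
  by rewrite big1 ?addr0 // => k ki; rewrite !mxE eq_sym (negbTE ki) mulr0.
rewrite linear_sum dotE; apply: eq_bigr => i _.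
by rewrite linearZ /= mxE deriveE // mulrC.
Qed.

Lemma is_derive_line f x v t : differentiable f (x + t *: v) ->
  is_derive t 1 (fun s => f (x + s *: v)) (dot (gradient f (x + t *: v)) v).
Proof.
move=> df.
have E : (fun h : R => h^-1 *: (((fun s => f (x + s *: v)) \o shift t) (h *: 1) -
    f (x + t *: v))) =
    (fun h : R => h^-1 *: ((f \o shift (x + t *: v)) (h *: v) - f (x + t *: v))).
  apply/funext => h /=; congr (_ *: (f _ - _)).
  by rewrite [h *: 1]mulr1 scalerDl addrCA.
apply: DeriveDef.
  by rewrite /derivable E; apply: diff_derivable.
by rewrite /derive E; apply: derive_gradient.
Qed.

Lemma differentiable_gradient_coord f x i : differentiable (gradient f) x ->
  differentiable (fun y => gradient f y i 0) x.
Proof.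
move=> dg; apply: (@differentiable_comp _ _ _ _ (gradient f)
  (fun N : 'M[R]_(d, 1) => N i 0 : R)) => //.
exact: differentiable_coord.
Qed.

Lemma is_derive_gradient_line f x u v t : differentiable (gradient f) (x + t *: v) ->
  is_derive t 1 (fun s => dot u (gradient f (x + s *: v)))
    (dot u (hessian f (x + t *: v) *m v)).
Proof.
move=> dg.
have D i : is_derive t 1 (fun s => gradient f (x + s *: v) i 0)
    ((hessian f (x + t *: v) *m v) i 0).
  have := is_derive_line (differentiable_gradient_coord i dg) => /is_derive_eq; apply.
  by rewrite dotE mxE; apply: eq_bigr => j _; rewrite !mxE.
rewrite (_ : (fun s => _) = \sum_i (fun s => u i 0 * gradient f (x + s *: v) i 0)).
  by rewrite dotE; apply: is_derive_sum => i; apply: is_deriveZ.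
by apply/funext => s; rewrite dotE fct_sumE.
Qed.

Lemma derivable_continuous (g : R -> R) a : derivable g a 1 -> {for a, continuous g}.
Proof. by move=> /derivable1_diffP; exact: differentiable_continuous. Qed.

Lemma mvt01 (g dg : R -> R) b : 0 < b -> (forall t, is_derive t 1 g (dg t)) ->
  exists2 c, 0 < c < b & g b - g 0 = dg c * b.
Proof.
move=> b0 D.
have gc : {within `[0, b], continuous g}.
  apply: continuous_subspaceT => t; apply: derivable_continuous.
  exact: (@ex_derive _ _ _ _ _ _ _ (D t)).
have [c cb E] := MVT b0 (fun t _ => D t) gc.
by exists c; [rewrite in_itv in cb|rewrite E subr0].
Qed.

(** Rolle's argument: [K] is chosen so that [q 0 = q 1], and a zero of [dq] inside the interval
    identifies [K]. Existence of the second derivative suffices, without continuity. *)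
Lemma taylor2 (p dp ddp : R -> R) : (forall t, is_derive t 1 p (dp t)) ->
  (forall t, is_derive t 1 dp (ddp t)) ->
  exists2 c, 0 < c < 1 & p 1 = p 0 + dp 0 + ddp c / 2.
Proof.
move=> D1 D2.
pose K := p 1 - p 0 - dp 0.
pose q := fun t : R => p t + dp t * (1 - t) + K * (1 - t) ^+ 2.
pose dq := fun t : R => ddp t * (1 - t) - 2 * K * (1 - t).
have Dq t : is_derive t 1 q (dq t).
  have d1 : is_derive t 1 (fun s : R => 1 - s) (- 1).
    rewrite (_ : (fun s : R => 1 - s) = cst 1 - id) //.
    by apply: is_derive_eq; rewrite sub0r.
  have d2 := @is_deriveX _ _ (fun s : R => 1 - s) 2 t 1 _ d1.
  have d3 := is_deriveM (D2 t) d1.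
  have d4 := is_deriveZ K d2.
  have := is_deriveD (is_deriveD (D1 t) d3) d4.
  rewrite (_ : p + _ + _ = q); last by apply/funext => s; rewrite /q !fctE.
  move=> /is_derive_eq; apply; rewrite /dq /GRing.scale /=.
  by ring.
have [c c01 E] := mvt01 ltr01 Dq; exists c => //.
have c1 : 1 - c != 0 by rewrite subr_eq0 eq_sym lt_eqF //; case/andP: c01.
have : dq c = 0.
  by move: E; rewrite mulr1 => <-; rewrite /q /K subrr subr0; ring.
rewrite /dq -mulrBl => /eqP; rewrite mulf_eq0 (negbTE c1) orbF subr_eq0 => /eqP ->.
by rewrite /K; field.
Qed.

Lemma continuous_sum (T : topologicalType) (I : Type) (r : seq I) (F : I -> T -> R) :
  (forall i, continuous (F i)) -> continuous (fun z => \sum_(i <- r) F i z).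
Proof. by move=> cF; apply: continuous_big => [|i _]; [exact: add_continuous|exact: cF]. Qed.

Lemma line0 x v : x + (0 : R) *: v = x. Proof. by rewrite scale0r addr0. Qed.
Lemma line1 x v : x + (1 : R) *: v = x + v. Proof. by rewrite scale1r. Qed.

Section C2.
Variable f : 'cV[R]_d -> R.
Hypothesis fC2 : C2 f.

Let df x : differentiable f x. Proof. by case: fC2. Qed.
Let dg x : differentiable (gradient f) x. Proof. by case: fC2. Qed.

Lemma C2_line x v t :
  is_derive t 1 (fun s => f (x + s *: v)) (dot (gradient f (x + t *: v)) v).
Proof. exact: is_derive_line. Qed.

Lemma C2_line2 x v t :
  is_derive t 1 (fun s => dot (gradient f (x + s *: v)) v)
    (dot v (hessian f (x + t *: v) *m v)).
Proof.
rewrite (_ : (fun s => _) = (fun s => dot v (gradient f (x + s *: v)))).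
  exact: is_derive_gradient_line.
by apply/funext => s; rewrite dotC.
Qed.

Lemma C2_taylor x v : exists2 t, 0 < t < 1 &
  f (x + v) = f x + dot (gradient f x) v + dot v (hessian f (x + t *: v) *m v) / 2.
Proof.
have [t t01 E] := taylor2 (C2_line x v) (C2_line2 x v).
by exists t => //; move: E; rewrite line1 !line0.
Qed.

Lemma C2_gradient_mvt x u v b : 0 < b -> exists2 t, 0 < t < b &
  dot u (gradient f (x + b *: v)) - dot u (gradient f x) =
    dot u (hessian f (x + t *: v) *m v) * b.
Proof.
move=> b0.
have [t tb E] := mvt01 b0 (fun t => is_derive_gradient_line u (dg (x + t *: v))).
by exists t => //; rewrite -E line0.
Qed.

Lemma continuous_hessian_form u v :
  continuous (fun y => dot u (hessian f y *m v) : R).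
Proof.
rewrite (_ : (fun y => _) = (fun y => \sum_i \sum_j u i 0 * (hessian f y i j * v j 0))).
  apply: continuous_sum => i; apply: continuous_sum => j.
  move=> x; have c : (fun y => hessian f y i j) @ x --> hessian f x i j.
    apply: (@cvg_comp _ _ _ (hessian f) (fun N : 'M[R]_d => N i j : R)
      (nbhs x) (nbhs (hessian f x))).
      by case: fC2 => _ _ _; exact.
    exact: (@coord_continuous _ _ _ i j (hessian f x)).
  exact: cvgMl_tmp (cvgMr_tmp (b := v j 0) c).
apply/funext => y; rewrite dotE; apply: eq_bigr => i _.
by rewrite mxE mulr_sumr.
Qed.

Lemma hessian_form_near x u v w z e : 0 < e -> exists2 r, 0 < r &
  forall s t, 0 <= s <= r -> 0 <= t <= r ->
  `|dot u (hessian f (x + s *: w + t *: z) *m v) - dot u (hessian f x *m v)| < e.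
Proof.
move=> e0.
have := @continuous_hessian_form u v x => /cvgrPdist_lt/(_ _ e0).
move=> /nbhs_normP[r /= r0 H].
pose K := `|w| + `|z| + 1.
have K0 : 0 < K by rewrite ltr_wpDl // addr_ge0.
exists (r / 2 / K); first by rewrite !divr_gt0.
move=> s t /andP[s0 sr] /andP[t0 tr]; rewrite distrC; apply: H => /=.
rewrite -addrA opprD addNKr normrN.
apply: le_lt_trans (ler_normD _ _) _.
rewrite !normrZ !ger0_norm //.
have : s * `|w| <= r / 2 / K * `|w| by rewrite ler_wpM2r.
have : t * `|z| <= r / 2 / K * `|z| by rewrite ler_wpM2r.
have : r / 2 / K * (`|w| + `|z|) <= r / 2.
  by rewrite -[leRHS]mulr1 -mulrA ler_wpM2l ?divr_ge0 ?(ltW r0) // ler_pdivrMl // mulr1 /K lerDl.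
by lra.
Qed.

(* Both mixed second derivatives are limits of the same second difference. *)
Lemma hessian_sym x : (hessian f x)^T = hessian f x.
Proof.
have key u v s : 0 < s -> exists a b, [/\ 0 <= a <= s, 0 <= b <= s &
    f (x + s *: u + s *: v) - f (x + s *: u) - f (x + s *: v) + f x =
    s ^+ 2 * dot u (hessian f (x + a *: u + b *: v) *m v)].
  move=> s0.
  pose g := fun r => f (x + s *: v + r *: u) - f (x + r *: u).
  have Dg (r : R) : is_derive r 1 g (dot (gradient f (x + s *: v + r *: u)) u -
      dot (gradient f (x + r *: u)) u).
    by apply: is_deriveB; apply: C2_line.
  have [a /andP[a0 as_] Ea] := mvt01 s0 Dg.
  have [b /andP[b0 bs] Eb] := C2_gradient_mvt (x + a *: u) u v s0.
  exists a, b; split; rewrite ?ltW //.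
  move: Ea; rewrite /g !line0 (addrAC x _ (s *: u)) => Ea.
  rewrite -[LHS](_ : f (x + s *: u + s *: v) - f (x + s *: u) - (f (x + s *: v) - f x) = _).
    rewrite Ea (addrAC x _ (a *: u)) !(dotC _ u) Eb; ring.
  by rewrite opprB addrA addrAC.
apply/matrixP => i j; rewrite mxE.
pose ei : 'cV[R]_d := delta_mx i 0; pose ej : 'cV[R]_d := delta_mx j 0.
have hE k l (M : 'M[R]_d) : M k l = dot (delta_mx k 0) (M *m delta_mx l 0).
  by rewrite dotC dot_delta_mx -colE mxE.
rewrite (hE j i) (hE i j) -/ei -/ej.
apply/eqP; rewrite -subr_eq0 -normr_le0; apply/ler_addgt0Pr => e e0; rewrite add0r.
have e2 : 0 < e / 2 by rewrite divr_gt0.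
have [r1 r10 H1] := hessian_form_near x ei ej ei ej e2.
have [r2 r20 H2] := hessian_form_near x ej ei ej ei e2.
pose s := Num.min r1 r2.
have s0 : 0 < s by rewrite lt_min r10.
have [a [b [/andP[a0 as_] /andP[b0 bs] Eab]]] := key ei ej s s0.
have [a' [b' [/andP[a0' as'] /andP[b0' bs'] Eab']]] := key ej ei s s0.
have sr1 : s <= r1 by rewrite ge_min lexx.
have sr2 : s <= r2 by rewrite ge_min lexx orbT.
have h1 : `|dot ei (hessian f (x + a *: ei + b *: ej) *m ej) -
  dot ei (hessian f x *m ej)| < e / 2.
  by apply: H1; apply/andP; split=> //; apply: le_trans sr1.
have h2 : `|dot ej (hessian f (x + a' *: ej + b' *: ei) *m ei) -
  dot ej (hessian f x *m ei)| < e / 2.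
  by apply: H2; apply/andP; split=> //; apply: le_trans sr2.
have E : dot ei (hessian f (x + a *: ei + b *: ej) *m ej) =
    dot ej (hessian f (x + a' *: ej + b' *: ei) *m ei).
  have s20 : s ^+ 2 != 0 by rewrite expf_neq0 // gt_eqF.
  apply: (mulfI s20); rewrite -Eab -Eab' (addrAC x).
  by congr (_ + _); exact: addrAC.
have fin (p q k l : R) : `|p - k| < e / 2 -> `|q - l| < e / 2 -> p = q -> `|l - k| <= e.
  move=> hp hq pq; rewrite -pq in hq; rewrite -(subrKA p) [e]splitr.
  by rewrite (le_trans (ler_normD _ _)) // lerD // ltW // distrC.
exact: fin h1 h2 E.
Qed.

(** Strong convexity at both orderings of [x] and [x + r v] makes the gradient strongly monotone.
    The mean value theorem turns this into a Hessian bound at a nearby point, and continuity moves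
    it to [x] up to [e]. *)
Lemma strongly_convex_hessian mu x v : strongly_convex mu f ->
  mu * dot v v <= dot v (hessian f x *m v).
Proof.
move=> sc; apply/ler_addgt0Pr => e e0.
have [r r0 H] := hessian_form_near x v v v 0 e0.
have [t /andP[t0 tr] E] := C2_gradient_mvt x v v r0.
have : `|dot v (hessian f (x + t *: v) *m v) - dot v (hessian f x *m v)| < e.
  by have := H t 0; rewrite scaler0 addr0 lexx !ltW //; apply.
move=> /ltr_normlP[_ h].
have h1 := sc (x + r *: v) x; have h2 := sc x (x + r *: v).
move: h1 h2.
rewrite (addrC x) addrK -(addrC x) opprD addNKr l2normN !l2norm_sqr.
rewrite -scaleNr !dotZr !dotZl !(dotC _ v) => h1 h2.
have h3 : r * (r * (mu * dot v v)) <= r * (r * dot v (hessian f (x + t *: v) *m v)).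
  rewrite (mulrC r (dot v (hessian f (x + _) *m v))) -E; move: h1 h2.
  move: (f x) (f _) (dot v v) (dot v (gradient f x)) (dot v (gradient f _)).
  by clear => *; lra.
rewrite !ler_pM2l // in h3.
by rewrite (le_trans h3) // -lerBlDl ltW.
Qed.

End C2.

Lemma gradient_minimizer f xs : (forall x, differentiable f x) -> minimizer f xs ->
  gradient f xs = 0.
Proof.
move=> df fm; apply: dot_eq0; set g := gradient f xs.
have D t := is_derive_line (df (xs + t *: g)).
have D0 : is_derive (0 : R) 1 (fun s => f (xs + s *: g)) 0.
  apply: (@derive1_at_min _ _ (-1) 1).
  - by apply: (le_trans _ (@ler01 R)); rewrite lerN10.
  - by move=> t _; apply: (@ex_derive _ _ _ _ _ _ _ (D t)).
  - by rewrite in_itv /= ltrN10 ltr01.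
  - by move=> t _; rewrite line0; exact: fm.
have := D 0; rewrite line0 -/g => D1.
by rewrite -(@derive_val _ _ _ _ _ _ _ D1) (@derive_val _ _ _ _ _ _ _ D0).
Qed.

End Calculus.

Local Opaque hessian gradient dot l2norm wnorm mulmx.

(** * Comparison of Hessians under either regularity assumption *)

Section Hessian.
Context {R : realType} {d : nat}.
Implicit Types (u v w x y h : 'cV[R]_d) (f : 'cV[R]_d -> R) (M A : 'M[R]_d).
Implicit Types (a b s t tau theta mu L : R).

(** The error is relative to the form at [x], so the notion is invariant under linear changes of
    coordinates and can be stated alike in both cases of the theorem. *)
Definition hessian_close f theta x y := forall v,
  `|dot v (hessian f y *m v) - dot v (hessian f x *m v)| <=
  theta * dot v (hessian f x *m v).

(** The Frobenius norm is a bound. Without one, the [sup] in [opnorm] could be a default value. *)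
Lemma l2norm_mulmx_bounded M : exists K : R, forall v, l2norm v <= 1 ->
  l2norm (M *m v) <= K.
Proof.
exists (Num.sqrt (\sum_i dot (row i M)^T (row i M)^T)) => v v1.
rewrite -[leLHS](ger0_norm (l2norm_ge0 _)); apply: ler_norm_of_sqr.
  exact: sqrtr_ge0.
rewrite l2norm_sqr sqr_sqrtr; last by apply: sumr_ge0 => i _; exact: dot_ge0.
rewrite dotE; apply: ler_sum => i _; rewrite -expr2.
rewrite mulmx_coord.
have := psd_cauchy_schwarz (row i M)^T v psd1; rewrite !mul1mx => /le_trans; apply.
rewrite ler_piMr ?dot_ge0 // -l2norm_sqr expr_le1 ?l2norm_ge0 //.
Qed.

Lemma l2norm_mulmx_opnorm M v : l2norm (M *m v) <= opnorm M * l2norm v.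
Proof.
have [v0|vn0] := eqVneq (l2norm v) 0.
  by rewrite (l2norm_eq0 v0) mulmx0 !l2norm0 mulr0.
have vp : 0 < l2norm v by rewrite lt0r vn0 l2norm_ge0.
pose w := (l2norm v)^-1 *: v.
have vE : v = l2norm v *: w by rewrite scalerA divff // scale1r.
have w1 : l2norm w = 1 by rewrite l2normZ ger0_norm ?invr_ge0 ?l2norm_ge0 // mulVf.
rewrite [in leLHS]vE -scalemxAr l2normZ ger0_norm ?l2norm_ge0 // mulrC ler_wpM2r ?l2norm_ge0 //.
apply: ub_le_sup; last by exists w; rewrite //= w1.
have [K HK] := l2norm_mulmx_bounded M.
by exists K => _ [z /= z1 <-]; exact: HK.
Qed.

(** This explains the power 3/2 of [mu] in the neighborhood: a factor [sqrt mu] passes from the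
    Hessian norm of [y - x] to its Euclidean norm, and a factor [mu] passes from the Euclidean form
    in [v] back to the Hessian form. *)
Lemma lipschitz_hessian_close f mu L r theta x y :
  0 < mu -> 0 < L -> (forall v, mu * dot v v <= dot v (hessian f x *m v)) ->
  lipschitz_hessian L f -> 0 <= theta -> r <= theta * (mu `^ (3 / 2) / L) ->
  wnorm (hessian f x) (y - x) <= r -> hessian_close f theta x y.
Proof.
move=> mu0 L0 Hmu Lip theta0 rle yx v.
set H := hessian f x in Hmu yx *.
have smu : 0 < Num.sqrt mu by rewrite sqrtr_gt0.
have -> : dot v (hessian f y *m v) - dot v (H *m v) = dot v ((hessian f y - H) *m v).
  by rewrite mulmxBl dotBr.
rewrite (le_trans (norm_dot _ _)) //.
have n1 : l2norm ((hessian f y - H) *m v) <= L * l2norm (y - x) * l2norm v.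
  rewrite (le_trans (l2norm_mulmx_opnorm _ _)) // ler_wpM2r ?l2norm_ge0 //.
  exact: Lip.
have n2 : l2norm (y - x) * Num.sqrt mu <= r.
  by rewrite mulrC (le_trans _ yx) // sqrt_l2norm_le_wnorm // ltW.
have mu32 : mu `^ (3 / 2) = mu * Num.sqrt mu.
  have -> : (3 / 2 : R) = 1 + 2^-1 by field.
  by rewrite powRD ?(gt_eqF mu0) ?implybT // powRr1 ?(ltW mu0) // powR12_sqrt // ltW.
have n3 : L * l2norm (y - x) <= theta * mu.
  rewrite -(ler_pM2r smu) -mulrA (le_trans (ler_wpM2l (ltW L0) n2)) //.
  rewrite (le_trans (ler_wpM2l (ltW L0) rle)) // mu32.
  have -> // : L * (theta * (mu * Num.sqrt mu / L)) = theta * mu * Num.sqrt mu.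
  by field; rewrite gt_eqF.
have n4 : l2norm v * l2norm ((hessian f y - H) *m v) <= theta * mu * dot v v.
  rewrite (le_trans (ler_wpM2l (l2norm_ge0 v) n1)) // mulrCA -expr2 l2norm_sqr.
  by rewrite ler_wpM2r ?dot_ge0.
by rewrite (le_trans n4) // -mulrA ler_wpM2l.
Qed.

(** Self-concordance says that the derivative of p^(-1/2) is at most 1 in absolute value. Hence the
    root of [p t] lies between a / (1 + a) and a / (1 - a), and the stated bounds are linear
    estimates of the squares for a <= 1/4. *)
Lemma self_concordant_line1d (p dp : R -> R) a t : (forall s, 0 < p s) ->
  (forall s, is_derive s 1 p (dp s)) ->
  (forall s, `|dp s| <= 2 * p s `^ (3 / 2)) ->
  p 0 = a ^+ 2 -> 0 < a <= 1 / 4 -> 0 < t <= 1 ->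
  a ^+ 2 * (1 - 2 * a) <= p t <= a ^+ 2 * (1 + 4 * a).
Proof.
move=> p0 Dp dp_le pa /andP[a0 a4] /andP[t0 t1].
pose q := (fun z : R => z `^ (- 2^-1)) \o p.
have Dq s : is_derive s 1 q (- 2^-1 * p s `^ (- 2^-1 - 1) * dp s).
  by apply: is_derive1_comp; exact: is_derive1_powR.
have [c c01 E] := mvt01 t0 Dq.
have dq1 : `|- 2^-1 * p c `^ (- 2^-1 - 1) * dp c| <= 1.
  rewrite !normrM normrN (ger0_norm (powR_ge0 _ _)) (@ger0_norm _ 2^-1) ?invr_ge0 //.
  have pc : 0 < p c `^ (3 / 2) by rewrite powR_gt0.
  have -> : (- 2^-1 - 1 : R) = - (3 / 2) by field.
  rewrite powRN -mulrA -ler_pdivlMl ?invr_gt0 // invrK mulr1.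
  by rewrite ler_pdivrMl // mulrC.
have qE s : q s = (Num.sqrt (p s))^-1 by rewrite /q /= powRN powR12_sqrt // ltW.
have q0 : q 0 = a^-1 by rewrite qE pa sqrtr_sqr gtr0_norm.
have sp : 0 < Num.sqrt (p t) by rewrite sqrtr_gt0.
have pt : p t = Num.sqrt (p t) ^+ 2 by rewrite sqr_sqrtr // ltW.
have : `|(Num.sqrt (p t))^-1 - a^-1| <= 1.
  rewrite -q0 -qE E normrM (gtr0_norm t0).
  by apply: mulr_ile1; rewrite // ltW.
move: sp pt; set z := Num.sqrt (p t) => z0 ->.
have -> : z^-1 - a^-1 = (a - z) / (z * a) by field; rewrite !gt_eqF.
have za : 0 < z * a by rewrite mulr_gt0.
rewrite normrM (gtr0_norm (_ : 0 < (z * a)^-1)) ?invr_gt0 //.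
rewrite ler_pdivrMr // mul1r => /ler_normlP[h1 h2].
have z1 : z * (1 - a) <= a by lra.
have z2 : a <= z * (1 + a) by lra.
have z12 : (z * (1 - a)) ^+ 2 <= a ^+ 2 by rewrite ler_sqr ?nnegrE ?mulr_ge0 //; lra.
have z22 : a ^+ 2 <= (z * (1 + a)) ^+ 2 by rewrite ler_sqr ?nnegrE ?mulr_ge0 //; lra.
have aa0 : 0 <= a ^+ 2 by rewrite sqr_ge0.
have zz0 : 0 <= z ^+ 2 by rewrite sqr_ge0.
apply/andP; split.
  apply: (@le_trans _ _ ((z * (1 + a)) ^+ 2 * (1 - 2 * a))).
    by rewrite ler_wpM2r //; lra.
  have -> : (z * (1 + a)) ^+ 2 * (1 - 2 * a) = z ^+ 2 * (1 - a ^+ 2 * (3 + 2 * a)) by ring.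
  rewrite ler_piMr // gerBl mulr_ge0 //; lra.
apply: (@le_trans _ _ ((z * (1 - a)) ^+ 2 * (1 + 4 * a))); last first.
  by rewrite ler_wpM2r //; lra.
have -> : (z * (1 - a)) ^+ 2 * (1 + 4 * a) = z ^+ 2 * (1 + a * (2 - 7 * a + 4 * a ^+ 2)) by ring.
rewrite ler_peMr // lerDl mulr_ge0 ?(ltW a0) //; lra.
Qed.

Lemma norm_sub_le0 (a b t : R) : a = 0 -> b = 0 -> `|a - b| <= t * b.
Proof. by move=> -> ->; rewrite subr0 normr0 mulr0. Qed.

Lemma norm_sub_le_subst (a b a' b' t : R) : a = a' -> b = b' ->
  `|a - b| <= t * b -> `|a' - b'| <= t * b'.
Proof. by move=> -> ->. Qed.

Let eighth_le_quarter : (1 / 8 : R) <= 1 / 4.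
Proof. by lra. Qed.

(** The first estimate gives D >= 1/64 - 4/512 = 1/128, the second D <= 10^(-4) + 36 * 10^(-6). *)
Lemma second_difference_contra (D z e : R) : 0 < e -> e <= 1 / 100 -> 0 <= z <= e ->
  `|D - (1 / 8) ^+ 2| <= 4 * (1 / 8) ^+ 3 -> `|D - z ^+ 2| <= 36 * e ^+ 3 -> False.
Proof.
move=> e0 e100 /andP[z0 ze] /ler_normlP[h1 _] /ler_normlP[_ h2].
have : z ^+ 2 <= e ^+ 2 by rewrite lerXn2r ?nnegrE ?(ltW e0).
have : e ^+ 2 <= (1 / 100) ^+ 2 by rewrite lerXn2r ?nnegrE ?(ltW e0) ?divr_ge0.
have : e ^+ 3 <= (1 / 100) ^+ 3 by rewrite lerXn2r ?nnegrE ?(ltW e0) ?divr_ge0.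
by lra.
Qed.

(** For b <= 1/8 the error 4 b^3 is at most half of b^2, so b^2 <= 3 e^2 and b <= 2 e. Then b^3 <= 6
    e^3, and 60 = 4 * 6 + 36. *)
Lemma second_difference_compare (D b e : R) : 0 < e -> e <= 1 / 100 -> 0 < b <= 1 / 8 ->
  `|D - b ^+ 2| <= 4 * b ^+ 3 -> `|D - e ^+ 2| <= 36 * e ^+ 3 ->
  `|b ^+ 2 - e ^+ 2| <= 60 * e * e ^+ 2.
Proof.
move=> e0 e100 /andP[b0 b8] /ler_normlP[h1 h2] /ler_normlP[h3 h4].
have e2 : 0 < e ^+ 2 by rewrite exprn_gt0.
have bb : 0 < b ^+ 2 by rewrite exprn_gt0.
have b3 : b ^+ 3 = b * b ^+ 2 by rewrite exprS.
have e33 : e ^+ 3 = e * e ^+ 2 by rewrite exprS.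
have e100' : e ^+ 3 <= 1 / 100 * e ^+ 2 by rewrite e33 ler_pM2r.
have b8' : b ^+ 3 <= 1 / 8 * b ^+ 2 by rewrite b3 ler_pM2r.
have b_le : b ^+ 2 <= 3 * e ^+ 2 by lra.
have b2e : b <= 2 * e.
  rewrite -ler_sqr ?nnegrE ?mulr_ge0 ?(ltW b0) ?(ltW e0) // (le_trans b_le) //.
  by rewrite exprMn; lra.
have b3e : b ^+ 3 <= 6 * e ^+ 3.
  rewrite b3 (le_trans (ler_pM (ltW b0) (ltW bb) b2e b_le)) //.
  by rewrite e33; lra.
have -> : 60 * e * e ^+ 2 = 60 * e ^+ 3 by ring.
by apply/ler_normlP; split; lra.
Qed.

Section SelfConcordant.
Variables (f : 'cV[R]_d -> R) (mu : R).
Hypotheses (fC2 : C2 f) (mu0 : 0 < mu).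
Hypothesis Hmu : forall x v, mu * dot v v <= dot v (hessian f x *m v).
Hypothesis fsc : self_concordant f.

Let N x v := wnorm (hessian f x) v.

Let psdH x : psd (hessian f x).
Proof.
split; first exact: hessian_sym.
by move=> v; apply: le_trans (Hmu x v); rewrite mulr_ge0 ?dot_ge0 ?ltW.
Qed.

Let form_gt0 x v : v != 0 -> 0 < dot v (hessian f x *m v).
Proof.
move=> vn0; apply: lt_le_trans (Hmu x v); rewrite mulr_gt0 // lt0r dot_ge0 andbT.
by apply: contra vn0 => /eqP/dot_eq0 ->.
Qed.

Let N_gt0 x v : v != 0 -> 0 < N x v.
Proof. by move=> vn0; rewrite wnorm_gt0 // form_gt0. Qed.

(** Only the line through [x] in the direction [v] is used: the exact second-order remainder is half
    the Hessian form at an intermediate point, which [self_concordant_line1d] compares with the form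
    at [x]. *)
Lemma self_concordant_taylor x v : N x v <= 1 / 4 ->
  `|f (x + v) - f x - dot (gradient f x) v - N x v ^+ 2 / 2| <= 2 * N x v ^+ 3.
Proof.
have [->|vn0] := eqVneq v 0.
  by rewrite /N wnorm0 addr0 dot0r subrr !expr0n !subr0 mul0r subr0 normr0 mulr0.
set a := N x v => a4.
have a0 : 0 < a := N_gt0 x vn0.
pose phi := fun s : R => f (x + s *: v).
pose p := fun s : R => dot v (hessian f (x + s *: v) *m v).
have phi2 : derive1n 2 phi = p.
  rewrite /derive1n /=.
  have -> : derive1 phi = fun s => dot (gradient f (x + s *: v)) v.
    apply/funext => s; rewrite derive1E.
    exact: (@derive_val _ _ _ _ _ _ _ (C2_line fC2 x v s)).
  apply/funext => s; rewrite derive1E.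
  exact: (@derive_val _ _ _ _ _ _ _ (C2_line2 fC2 x v s)).
have [dphi phi3] := fsc x v; rewrite -/phi in dphi phi3.
have Dp s : is_derive s 1 p (derive1n 3 phi s).
  rewrite derive1nS phi2 derive1E; apply: derivableP.
  by have := dphi 2%N s isT; rewrite phi2.
have [t /andP[t0 t1] E] := C2_taylor fC2 x v.
have p0 : p 0 = a ^+ 2 by rewrite /p line0 wnorm_sqr.
have /andP[b1 b2] : a ^+ 2 * (1 - 2 * a) <= p t <= a ^+ 2 * (1 + 4 * a).
  apply: (self_concordant_line1d _ Dp) => //.
  - by move=> s; exact: form_gt0.
  - by move=> s; rewrite -phi2; exact: phi3.
  - by rewrite a0.
  - by rewrite t0 ltW.
have -> : f (x + v) - f x - dot (gradient f x) v - a ^+ 2 / 2 = (p t - a ^+ 2) / 2.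
  rewrite E /p; by move: (f x) (dot (gradient f x) v) (dot v _); move=> *; field.
move: b1 b2; move: (p t); clear -a0 => q b1 b2.
have a30 : 0 < a ^+ 3 by rewrite exprn_gt0.
by apply/ler_normlP; split; rewrite !exprS in a30 b1 b2 *; lra.
Qed.

Lemma second_difference x u e (D := f (x + u) + f (x - u) - 2 * f x) :
  N x u = e -> e <= 1 / 4 -> `|D - e ^+ 2| <= 4 * e ^+ 3.
Proof.
move=> eN e4.
have := @self_concordant_taylor x u; have := @self_concordant_taylor x (- u).
rewrite /N wnormN -/(N x u) eN => /(_ e4) h1 /(_ e4) h2.
have -> : D - e ^+ 2 = (f (x + u) - f x - dot (gradient f x) u - e ^+ 2 / 2)
   + (f (x - u) - f x - dot (gradient f x) (- u) - e ^+ 2 / 2).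
  rewrite /D dotNr; by move: (f x) (f (x + u)) (f (x - u)) (dot _ u) => *; field.
rewrite (le_trans (ler_normD _ _)) //.
by apply: le_trans (lerD h2 h1) _; rewrite -mulrDl (_ : 2 + 2 = 4 :> R) //; ring.
Qed.

(** All three points are expanded around [x], where the parallelogram identity cancels the terms in
    [h]. The displacements [h + u] and [h - u] have length at most 2 e, so each costs 2 (2 e)^3; the
    doubled middle point costs 4 e^3, and 36 = 16 + 16 + 4. *)
Lemma shifted_second_difference x h u e
    (D := f (x + h + u) + f (x + h - u) - 2 * f (x + h)) :
  N x h = e -> N x u <= e -> e <= 1 / 100 -> `|D - N x u ^+ 2| <= 36 * e ^+ 3.
Proof.
move=> hN uN e100.
have e0 : 0 <= e by rewrite -hN wnorm_ge0.
have n1 : N x (h + u) <= 2 * e.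
  by rewrite (le_trans (wnormD _ _ (psdH x))) // -/(N x h) -/(N x u) hN; lra.
have n2 : N x (h - u) <= 2 * e.
  by rewrite (le_trans (wnormB _ _ (psdH x))) // -/(N x h) -/(N x u) hN; lra.
have par : N x (h + u) ^+ 2 + N x (h - u) ^+ 2 = 2 * e ^+ 2 + 2 * N x u ^+ 2.
  rewrite -hN /N !wnorm_sqr // !mulmxDr !mulmxN !(dotDl, dotDr, dotNl, dotNr).
  move: (dot h _) (dot h _) (dot u _) (dot u _) => *; ring.
have T0 := @self_concordant_taylor x h.
have T1 := @self_concordant_taylor x (h + u).
have T2 := @self_concordant_taylor x (h - u).
have {T0} T0 : `|f (x + h) - f x - dot (gradient f x) h - e ^+ 2 / 2| <= 2 * e ^+ 3.
  by move: T0; rewrite hN; apply; lra.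
have cub (z : R) : 0 <= z -> z <= 2 * e -> 2 * z ^+ 3 <= 16 * e ^+ 3.
  move=> z0 ze; have -> : 16 * e ^+ 3 = 2 * (2 * e) ^+ 3 by ring.
  by rewrite ler_pM2l // lerXn2r // nnegrE mulr_ge0.
have {T1} T1 := le_trans (T1 (le_trans n1 _)) (cub _ (wnorm_ge0 _ _) n1).
have {T2} T2 := le_trans (T2 (le_trans n2 _)) (cub _ (wnorm_ge0 _ _) n2).
have {}T1 : `|f (x + (h + u)) - f x - dot (gradient f x) (h + u) - N x (h + u) ^+ 2 / 2|
   <= 16 * e ^+ 3 by apply: T1; lra.
have {}T2 : `|f (x + (h - u)) - f x - dot (gradient f x) (h - u) - N x (h - u) ^+ 2 / 2|
   <= 16 * e ^+ 3 by apply: T2; lra.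
move: T0 T1 T2 par; rewrite /D !addrA dotBr dotDr.
move: (f x) (f (x + h)) (f (x + h + u)) (f (x + h - u)) (dot _ h) (dot _ u)
  (N x (h + u)) (N x (h - u)) (N x u).
clear => c0 c1 c2 c3 g1 g2 m1 m2 m3.
move=> /ler_normlP[? ?] /ler_normlP[? ?] /ler_normlP[? ?] par.
by apply/ler_normlP; split; lra.
Qed.

(* Self-concordance controls the third derivative only along a single direction,
   so the Hessians at [x] and [x + h] are compared in the direction [u] through a
   second difference of [f], expanded around either point. *)
Lemma self_concordant_compare_scaled x h u e : 0 < e -> e <= 1 / 100 ->
  N x h = e -> N x u = e -> `|N (x + h) u ^+ 2 - e ^+ 2| <= 60 * e * e ^+ 2.
Proof.
move=> e0 e100 hN uN; set y := x + h; set b := N y u.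
have un0 : u != 0.
  by apply/eqP => u0; move: uN; rewrite u0 /N wnorm0 => e00; rewrite -e00 ltxx in e0.
have b0 : 0 < b := N_gt0 y un0.
have b8 : b <= 1 / 8.
  rewrite leNgt; apply/negP => b8.
  have b80 : 0 < 8 * b by rewrite mulr_gt0.
  (* otherwise rescale [u] so that the second difference at [y] is too large *)
  pose k := (8 * b)^-1; pose w := k *: u.
  have k0 : 0 < k by rewrite invr_gt0.
  have k1 : k <= 1.
    by rewrite invf_le1 // mulrC -ler_pdivrMr // ltW.
  have wy : N y w = 1 / 8.
    by rewrite /N wnormZ (gtr0_norm k0) -/(N y u) -/b /k invfM mulrVK ?unitfE ?(gt_eqF b0) // mul1r.
  have wx : N x w <= e.
    by rewrite /N wnormZ (gtr0_norm k0) -/(N x u) uN ler_piMl // ltW.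
  have := shifted_second_difference hN wx e100; rewrite -/y.
  have := second_difference wy eighth_le_quarter.
  by apply: second_difference_contra; rewrite // wnorm_ge0.
have uNe : N x u <= e by rewrite uN.
have := shifted_second_difference hN uNe e100; rewrite -/y uN.
have := second_difference (erefl b) (le_trans b8 eighth_le_quarter).
by apply: second_difference_compare; rewrite // b0.
Qed.

(** Both sides are homogeneous of degree two in the direction, which may thus be rescaled to the
    length [e] of the displacement. At that scale a cubic error [60 * e ^+ 3] is a relative error
    [60 * e]. *)
Lemma self_concordant_close x y : N x (y - x) <= 1 / 100 ->
  hessian_close f (60 * N x (y - x)) x y.
Proof.
set h := y - x; set e := N x h => e100 u.
have yE : y = x + h by rewrite /h addrC subrK.
have [h0|hn0] := eqVneq h 0.
  by rewrite yE h0 addr0 subrr normr0 /e h0 /N wnorm0 mulr0 mul0r.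
have e0 : 0 < e := N_gt0 x hn0.
have [u0|un0] := eqVneq u 0.
  by apply: norm_sub_le0; exact: dot_quad0.
have n0 := N_gt0 x un0.
pose k := e / N x u.
have k0 : 0 < k by rewrite divr_gt0.
have kN : N x (k *: u) = e.
  by rewrite /N wnormZ (gtr0_norm k0) -/(N x u) /k mulfVK // gt_eqF.
have := self_concordant_compare_scaled e0 e100 (erefl : N x h = e) kN.
have e2 : e ^+ 2 = k ^+ 2 * N x u ^+ 2.
  by rewrite -exprMn /k mulfVK // gt_eqF.
rewrite -yE /N wnormZ (gtr0_norm k0) exprMn e2 -mulrBr normrM.
rewrite (ger0_norm (sqr_ge0 k)) mulrCA ler_pM2l ?exprn_gt0 //.
by apply: norm_sub_le_subst; exact: wnorm_sqr.
Qed.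

End SelfConcordant.

(** In the application [a] and [b] are the squared lengths of [y - xs] in the forms at [xs] and
    [xt], and [c] and [e] those of [xt - xs]. Changing form twice costs (1 + theta) / (1 - theta) <=
    2, within the factor 4 that the halved radius allows. *)
Lemma recenter_ball (a b c e r theta : R) : 0 <= theta <= 1 / 3 ->
  0 <= a -> `|b - a| <= theta * a -> `|e - c| <= theta * c -> b <= e ->
  c <= (r / 2) ^+ 2 -> a <= r ^+ 2.
Proof.
move=> /andP[t0 t3] a0 /ler_normlP[h1 _] /ler_normlP[_ h2] be.
rewrite expr_div_n => c0.
have : theta * a <= 1 / 3 * a by rewrite ler_wpM2r.
have r20 : 0 <= r ^+ 2 by rewrite sqr_ge0.
have : (1 + theta) * c <= (1 + theta) * (r ^+ 2 / 2 ^+ 2) by rewrite ler_wpM2l //; lra.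
have : theta * (r ^+ 2 / 2 ^+ 2) <= 1 / 3 * (r ^+ 2 / 2 ^+ 2).
  by rewrite ler_wpM2r // divr_ge0 // exprn_ge0.
by lra.
Qed.

Lemma recenter_close (a b c theta : R) : 0 <= theta <= 1 / 3 ->
  0 <= a -> `|c - a| <= theta * a -> `|b - a| <= theta * a ->
  `|b - c| <= 3 * theta * c.
Proof.
move=> /andP[t0 t3] a0 /ler_normlP[h1 h2] /ler_normlP[h3 h4].
have h5 : theta * a <= 1 / 3 * a by rewrite ler_wpM2r.
have : theta * a <= theta * (3 / 2 * c) by rewrite ler_wpM2l //; lra.
by move=> h6; apply/ler_normlP; split; lra.
Qed.

(** The neighborhood of the theorem is centered at the minimizer and measured by its Hessian, while
    the recursion uses the Hessian at the snapshot [xt]. Passing through [xs] doubles the error, and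
    renormalizing by the form at [xt] costs another 3/2. *)
Lemma hessian_close_recenter f theta r xs xt y :
  (forall x, psd (hessian f x)) -> 0 <= theta <= 1 / 3 ->
  (forall z, wnorm (hessian f xs) (z - xs) <= r -> hessian_close f theta xs z) ->
  wnorm (hessian f xs) (xt - xs) <= r / 2 ->
  wnorm (hessian f xt) (y - xs) <= wnorm (hessian f xt) (xt - xs) ->
  hessian_close f (3 * theta) xt y.
Proof.
move=> psdH t3 close xtr yxt.
have r20 : 0 <= r / 2 := le_trans (wnorm_ge0 _ _) xtr.
have r0 : 0 <= r by rewrite -(pmulr_lge0 r (_ : 0 < 2^-1)) ?invr_gt0.
have r2r : r / 2 <= r by rewrite ler_pdivrMr // ler_peMr // ler1n.
have Ct := close xt (le_trans xtr r2r).
have ball : wnorm (hessian f xs) (y - xs) <= r.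
  apply/(wnorm_leP _ (psdH xs) r0).
  apply: (recenter_ball t3 _ (Ct (y - xs)) (Ct (xt - xs))).
  - exact: (proj2 (psdH xs)).
  - exact: (wnorm_le_dot (psdH xt)).
  - by apply/(wnorm_leP _ (psdH xs) r20).
move=> v; exact: (recenter_close t3 (proj2 (psdH xs) v) (Ct v) (close y ball v)).
Qed.

End Hessian.

Local Transparent mulmx.

(** * The recursion for the iterates *)

Section Recursion.
Context {R : realType}.
Implicit Types (a b c n q alpha beta u v : R).

(** Convexity of the square, with [b] written as [beta] times [b / beta]. *)
Lemma sqr_convex_comb a b c beta : 0 < beta <= 1 -> 0 <= c ->
  c <= (1 - beta) * a + b -> c ^+ 2 <= (1 - beta) * a ^+ 2 + b ^+ 2 / beta.
Proof.
move=> /andP[b0 b1] c0 h.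
have b0' : beta != 0 by rewrite gt_eqF.
have h1 : c ^+ 2 <= ((1 - beta) * a + b) ^+ 2 by rewrite lerXn2r ?nnegrE // (le_trans c0 h).
apply: le_trans h1 _; rewrite -subr_ge0.
have -> : (1 - beta) * a ^+ 2 + b ^+ 2 / beta - ((1 - beta) * a + b) ^+ 2 =
  (1 - beta) * beta * (a - b / beta) ^+ 2 by field.
by rewrite mulr_ge0 ?sqr_ge0 // mulr_ge0 ?subr_ge0 // ltW.
Qed.

(** The Hessian error lowers the contraction from 1 to 15/16 (in units of 1 / alpha), which is
    [beta]. The noise contributes (12/5) * 40 = 96 times [alpha * q * (a ^+ 2 + E0)]; since 96/3000
    < 1/16, its part in [a] lowers 15/16 to no less than 7/8. *)
Lemma step_sqr alpha q a b c n (E0 : R) : 1 <= alpha -> 0 <= q -> 60 * 50 * alpha ^+ 2 * q <= 1 ->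
  0 <= c -> 0 <= E0 ->
  c <= (1 - 1 / alpha + 3 / 2 * (1 / (24 * alpha))) * a + 3 / 2 * b ->
  b ^+ 2 <= 20 * q * n -> n <= 2 * (a ^+ 2 + E0) ->
  c ^+ 2 <= (1 - 7 / (8 * alpha)) * a ^+ 2 + 96 * alpha * q * E0.
Proof.
move=> a1 q0 aq c0 E00 h hb hn.
have al0 : 0 < alpha by lra.
have al0' : alpha != 0 by rewrite gt_eqF.
pose beta := 15 / (16 * alpha).
have beta0 : 0 < beta by rewrite divr_gt0 // mulr_gt0.
have ia0 : 0 < alpha^-1 by rewrite invr_gt0.
have ia1 : alpha^-1 <= 1 by rewrite invf_le1.
have betaE : beta = 15 / 16 * alpha^-1 by rewrite /beta; field.
have beta1 : beta <= 1 by rewrite betaE; lra.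
have h' : c <= (1 - beta) * a + 3 / 2 * b.
  have <- // : 1 - 1 / alpha + 3 / 2 * (1 / (24 * alpha)) = 1 - beta.
  by rewrite betaE; field.
have beta01 : 0 < beta <= 1 by rewrite beta0.
apply: le_trans (sqr_convex_comb beta01 c0 h') _.
have qn : q * n <= q * (2 * (a ^+ 2 + E0)) by rewrite ler_wpM2l.
have -> : (3 / 2 * b) ^+ 2 / beta = 12 / 5 * alpha * b ^+ 2.
  by rewrite /beta; field; rewrite al0'.
have h2 : 12 / 5 * alpha * b ^+ 2 <= 12 / 5 * alpha * (40 * (q * (a ^+ 2 + E0))).
  rewrite ler_wpM2l ?mulr_ge0 ?(ltW al0) ?divr_ge0 //; lra.
apply: le_trans (lerD (lexx _) h2) _.
have aa : 0 <= a ^+ 2 by rewrite sqr_ge0.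
have aqi : 60 * 50 * (alpha * q) <= alpha^-1.
  rewrite -(ler_pM2l al0) divff //.
  by have -> : alpha * (60 * 50 * (alpha * q)) = 60 * 50 * alpha ^+ 2 * q by ring.
have h3 : 60 * 50 * (alpha * q) * a ^+ 2 <= alpha^-1 * a ^+ 2 by rewrite ler_wpM2r.
have h4 : 0 <= alpha * q * E0 by rewrite !mulr_ge0 // ltW.
have -> : 7 / (8 * alpha) = 7 / 8 * alpha^-1 by field.
have h5 : 0 <= alpha^-1 * a ^+ 2 by rewrite mulr_ge0 // ltW.
rewrite betaE; lra.
Qed.

(** The step is available only while [E j <= E 0], so this is part of the induction. The fixed point
    of the affine recursion is 96 * 8/7 < 110 times [alpha ^+ 2 * q * E 0]. *)
Lemma recursion_bound alpha q (E : nat -> R) t : 1 <= alpha -> 0 <= q ->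
  60 * 50 * alpha ^+ 2 * q <= 1 -> (forall j, 0 <= E j) ->
  (forall j, (j < t)%N -> E j <= E 0%N ->
     E j.+1 <= (1 - 7 / (8 * alpha)) * E j + 96 * alpha * q * E 0%N) ->
  forall j, (j <= t)%N -> E j <= E 0%N /\
    E j <= ((1 - 7 / (8 * alpha)) ^+ j + 110 * alpha ^+ 2 * q) * E 0%N.
Proof.
move=> a1 q0 aq E0 HE.
have al0 : 0 < alpha by lra.
have al0' : alpha != 0 by rewrite gt_eqF.
have ia0 : 0 < alpha^-1 by rewrite invr_gt0.
have ia1 : alpha^-1 <= 1 by rewrite invf_le1.
have gE : 1 - 7 / (8 * alpha) = 1 - 7 / 8 * alpha^-1 by field.
have g0 : 0 <= 1 - 7 / (8 * alpha) by rewrite gE; lra.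
have aqi : 60 * 50 * (alpha * q) <= alpha^-1.
  rewrite -(ler_pM2l al0) divff //.
  by have -> : alpha * (60 * 50 * (alpha * q)) = 60 * 50 * alpha ^+ 2 * q by ring.
have aq0 : 0 <= alpha * q by rewrite mulr_ge0 // ltW.
elim=> [_|j IH jt].
  split=> //; rewrite expr0 mulrDl mul1r lerDl mulr_ge0 // mulr_ge0 // mulr_ge0 //.
  exact: sqr_ge0.
have [IH1 IH2] := IH (ltnW jt).
have h := HE j jt IH1.
have h1 := ler_wpM2l g0 IH1; have h2 := ler_wpM2l g0 IH2.
have h3 : 60 * 50 * (alpha * q) * E 0%N <= alpha^-1 * E 0%N by rewrite ler_wpM2r.
have h4 : 0 <= alpha^-1 * E 0%N by rewrite mulr_ge0 // ltW.
split; first by apply: le_trans h _; move: h1; rewrite gE; lra.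
apply: le_trans h _; apply: le_trans (lerD h2 (lexx _)) _.
rewrite (exprS _ j); set g := (1 - _) ^+ j.
have h5 : 0 <= alpha * q * E 0%N by rewrite mulr_ge0.
have -> : (1 - 7 / (8 * alpha)) * ((g + 110 * alpha ^+ 2 * q) * E 0%N) +
   96 * alpha * q * E 0%N = ((1 - 7 / (8 * alpha)) * g + 110 * alpha ^+ 2 * q) * E 0%N
   - 1 / 4 * (alpha * q * E 0%N) by field.
by rewrite gerBl mulr_ge0 // divr_ge0.
Qed.

(** Passing between values and squared distances costs at most 1 + 1 / (8 alpha), once. One factor
    of the power pays for it, because (1 + 1 / (8 alpha)) (1 - 7 / (8 alpha)) <= 1 - 1 / (2 alpha);
    this is where t >= 1 enters. *)
Lemma ratio_bound alpha q u v (E0 Et : R) t : 1 <= alpha -> 0 <= q -> (0 < t)%N ->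
  0 <= E0 -> 0 <= Et ->
  u <= (1 + 1 / (24 * alpha)) / 2 * Et -> (1 - 1 / (24 * alpha)) / 2 * E0 <= v ->
  (E0 = 0 -> v = 0) ->
  Et <= ((1 - 7 / (8 * alpha)) ^+ t + 110 * alpha ^+ 2 * q) * E0 ->
  u / v <= (1 - 1 / (2 * alpha)) ^+ t + 60 * 50 * alpha ^+ 2 * q.
Proof.
move=> a1 q0 t0 E00 Et0 hu hv v0 hE.
have al0 : 0 < alpha by lra.
have al0' : alpha != 0 by rewrite gt_eqF.
have ia0 : 0 < alpha^-1 by rewrite invr_gt0.
have ia1 : alpha^-1 <= 1 by rewrite invf_le1.
have gE : 1 - 7 / (8 * alpha) = 1 - 7 / 8 * alpha^-1 by field.
have dE : 1 - 1 / (2 * alpha) = 1 - 1 / 2 * alpha^-1 by field.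
have eE : 1 / (24 * alpha) = 1 / 24 * alpha^-1 by field.
have g0 : 0 <= 1 - 7 / (8 * alpha) by rewrite gE; lra.
have d0 : 0 <= 1 - 1 / (2 * alpha) by rewrite dE; lra.
have aq0 : 0 <= alpha ^+ 2 * q by rewrite mulr_ge0 // sqr_ge0.
set G := (1 - 7 / _) ^+ t in hE *; set P := (1 - _) ^+ t.
have P0 : 0 <= P by rewrite exprn_ge0.
(* A snapshot already at the minimizer makes the denominator 0, and the quotient is then 0 by
   convention. *)
have [EE|En0] := eqVneq E0 0.
  rewrite (v0 EE) invr0 mulr0 addr_ge0 // -mulrA mulr_ge0 //.
have E0p : 0 < E0 by rewrite lt0r En0.
have vp : 0 < v by apply: lt_le_trans hv; rewrite mulr_gt0 // eE; lra.
have GP : (1 + 1 / 8 * alpha^-1) * G <= P.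
  have k1 : 1 <= 1 + 1 / 8 * alpha^-1 by lra.
  apply: (@le_trans _ _ ((1 + 1 / 8 * alpha^-1) ^+ t * G)).
    by rewrite ler_wpM2r ?exprn_ge0 // ler_eXnr.
  rewrite -exprMn lerXn2r ?nnegrE // ?mulr_ge0 //; first lra.
  rewrite gE dE; nra.
rewrite ler_pdivrMr //; apply: le_trans hu _.
have e0 : 0 <= 1 / (24 * alpha) by rewrite eE; lra.
have h1 : (1 + 1 / (24 * alpha)) / 2 * Et <=
    (1 + 1 / (24 * alpha)) / 2 * ((G + 110 * alpha ^+ 2 * q) * E0).
  by rewrite ler_wpM2l //; lra.
apply: le_trans h1 _.
have Q0 : 0 <= P + 60 * 50 * alpha ^+ 2 * q by rewrite addr_ge0 // -mulrA mulr_ge0.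
apply: le_trans (ler_wpM2l Q0 hv).
rewrite mulrA [leRHS]mulrA ler_wpM2r // eE.
have G0 : 0 <= G by rewrite exprn_ge0.
have k2 : 1 + 1 / 24 * alpha^-1 <= (1 - 1 / 24 * alpha^-1) * (1 + 1 / 8 * alpha^-1) by nra.
have k3 : (1 + 1 / 24 * alpha^-1) * G <= (1 - 1 / 24 * alpha^-1) * P.
  apply: le_trans (ler_wpM2r G0 k2) _; rewrite -(mulrA _ _ G) ler_wpM2l //; lra.
have k4 : (1 + 1 / 24 * alpha^-1) * (alpha ^+ 2 * q) <= 2 * (alpha ^+ 2 * q).
  by rewrite ler_wpM2r //; lra.
have k5 : 1 / 2 * (alpha ^+ 2 * q) <= (1 - 1 / 24 * alpha^-1) * (alpha ^+ 2 * q).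
  by rewrite ler_wpM2r //; lra.
lra.
Qed.

End Recursion.

(** * The quadratic model of the objective around the minimizer *)

Section Basin.
Context {R : realType} {d : nat}.
Variables (f : 'cV[R]_d -> R) (mu theta : R) (xs xt : 'cV[R]_d).
Hypotheses (fC2 : C2 f) (mu0 : 0 < mu) (theta0 : 0 <= theta).
Hypothesis Hmu : forall x v, mu * dot v v <= dot v (hessian f x *m v).
Hypothesis grad_xs : gradient f xs = 0.

Let A := hessian f xt.

Hypothesis close : forall y, wnorm A (y - xs) <= wnorm A (xt - xs) ->
  hessian_close f theta xt y.

Implicit Types (u v y : 'cV[R]_d).

Let psdA : psd A.
Proof. exact: (pd_psd mu0 (hessian_sym fC2 xt) (Hmu xt)). Qed.

Lemma ball_segment y t : wnorm A (y - xs) <= wnorm A (xt - xs) -> 0 < t < 1 ->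
  wnorm A (xs + t *: (y - xs) - xs) <= wnorm A (xt - xs).
Proof.
move=> yb /andP[t0 t1]; rewrite (addrC xs) addrK wnormZ gtr0_norm //.
by apply: le_trans yb; rewrite ler_piMl ?wnorm_ge0 // ltW.
Qed.

(** The mean value theorem is applied to the gradient paired with [u], so the intermediate point
    depends on [u]. Closeness of Hessians is known on the diagonal only, and polarization supplies
    the pairing of [u] with [y - xs]. *)
Lemma gradient_approx y u : wnorm A (y - xs) <= wnorm A (xt - xs) ->
  `|dot u (gradient f y - A *m (y - xs))| <= theta * wnorm A (y - xs) * wnorm A u.
Proof.
move=> yb; have [t t01] := C2_gradient_mvt fC2 xs u (y - xs) ltr01.
rewrite scale1r (addrC xs) subrK grad_xs dot0r subr0 mulr1 => E.
set z := xs + t *: (y - xs) in E.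
have zb : wnorm A (z - xs) <= wnorm A (xt - xs) by exact: ball_segment.
have -> : dot u (gradient f y - A *m (y - xs)) = dot u ((hessian f z - A) *m (y - xs)).
  by rewrite dotBr E mulmxBl dotBr.
apply: ler_norm_of_sqr; first by rewrite !mulr_ge0 ?wnorm_ge0.
have Ms := sub_sym (hessian_sym fC2 z) (hessian_sym fC2 xt).
have := @sym_form_bound _ _ A (hessian f z - A) theta u (y - xs) Ms (hessian_sym fC2 xt)
  (proj2 psdA) => h.
apply: le_trans (h _) _ => [w|].
  by rewrite mulmxBl dotBr; exact: (close zb).
by rewrite -!wnorm_sqr // -!exprMn (mulrC (wnorm A u)) mulrA.
Qed.

Lemma taylor_bound (p a c b b' : R) : `|p - a| <= theta * a -> c = a -> b = b' + p / 2 ->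
  (1 - theta) / 2 * c <= b - b' <= (1 + theta) / 2 * c.
Proof.
move=> /ler_normlP[h1 h2] -> ->; rewrite (addrC b') addrK.
by apply/andP; split; lra.
Qed.

Lemma value_bounds y : wnorm A (y - xs) <= wnorm A (xt - xs) ->
  (1 - theta) / 2 * wnorm A (y - xs) ^+ 2 <= f y - f xs <=
  (1 + theta) / 2 * wnorm A (y - xs) ^+ 2.
Proof.
move=> yb; have [t t01] := C2_taylor fC2 xs (y - xs).
rewrite (addrC xs) subrK grad_xs dot0l addr0 => E.
exact: (taylor_bound (close (ball_segment yb t01) (y - xs)) (wnorm_sqr _ psdA) E).
Qed.

(** The segment from [xt] to [y] stays in the ball by convexity of the norm. This divergence is what
    bounds the variance of the mini-batch gradient. *)
Lemma bregman_bound y : wnorm A (y - xs) <= wnorm A (xt - xs) ->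
  f y - f xt - dot (gradient f xt) (y - xt) <= (1 + theta) / 2 * wnorm A (y - xt) ^+ 2.
Proof.
move=> yb; have [t /andP[t0 t1]] := C2_taylor fC2 xt (y - xt).
rewrite (addrC xt) subrK => E.
have zb : wnorm A (xt + t *: (y - xt) - xs) <= wnorm A (xt - xs).
  have -> : xt + t *: (y - xt) - xs = (1 - t) *: (xt - xs) + t *: (y - xs).
    by apply/matrixP => i j; rewrite !mxE; ring.
  rewrite (le_trans (wnormD _ _ psdA)) // !wnormZ !gtr0_norm ?subr_gt0 //.
  rewrite [leRHS](_ : _ = (1 - t) * wnorm A (xt - xs) + t * wnorm A (xt - xs)); last by ring.
  by rewrite lerD2l ler_pM2l.
have /andP[_] := taylor_bound (close zb (y - xt)) (wnorm_sqr _ psdA) E.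
by rewrite opprD addrA.
Qed.

End Basin.

Section Iterates.
Context {R : realType} {d : nat}.

(** The deterministic half of the theorem, for one realization of the samples. The noise bound is
    assumed only at iterates in the ball, which is all that the complement of the bad events
    provides. *)
Lemma iterates_ratio (f : 'cV[R]_d -> R) (mu alpha q : R) (xs xt : 'cV[R]_d)
    (H : 'M[R]_d) (x : nat -> 'cV[R]_d) t
    (eta := Num.min (Num.sqrt (2 / alpha)) 1) (A := hessian f xt) :
  C2 f -> 0 < mu -> (forall x v, mu * dot v v <= dot v (hessian f x *m v)) ->
  gradient f xs = 0 -> 1 <= alpha -> 0 <= q -> 60 * 50 * alpha ^+ 2 * q <= 1 ->
  (0 < t)%N ->
  (forall y, wnorm A (y - xs) <= wnorm A (xt - xs) ->
    hessian_close f (1 / (24 * alpha)) xt y) ->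
  H^T = H -> loewner_le ((1 / Num.sqrt alpha) *: A) H ->
  loewner_le H (Num.sqrt alpha *: A) ->
  x 0%N = xt ->
  (forall j, (j < t)%N -> exists2 xi : 'cV[R]_d,
    x j.+1 = x j - eta *: (invmx H *m (xi + gradient f (x j))) &
    wnorm A (x j - xs) <= wnorm A (xt - xs) ->
    l2norm xi ^+ 2 <= 20 * (q * mu) * wnorm A (x j - xt) ^+ 2) ->
  (f (x t) - f xs) / (f xt - f xs) <= (1 - 1 / (2 * alpha)) ^+ t + 60 * 50 * alpha ^+ 2 * q.
Proof.
move=> fC2 mu0 Hmu grad_xs a1 q0 aq t0 close Hs AH HA x0 xS.
have al0 : 0 < alpha := lt_le_trans ltr01 a1.
have th0 : 0 <= 1 / (24 * alpha) by rewrite divr_ge0 // mulr_ge0 // ltW.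
have As : A^T = A := hessian_sym fC2 xt.
have psdA : psd A := pd_psd mu0 As (Hmu xt).
have smu : 0 < Num.sqrt mu by rewrite sqrtr_gt0.
pose E j := wnorm A (x j - xs) ^+ 2.
have E0E : E 0%N = wnorm A (xt - xs) ^+ 2 by rewrite /E x0.
have Epos j : 0 <= E j by rewrite exprn_ge0 // wnorm_ge0.
have ball j : E j <= E 0%N -> wnorm A (x j - xs) <= wnorm A (xt - xs).
  by rewrite E0E ler_sqr // nnegrE wnorm_ge0.
have step j : (j < t)%N -> E j <= E 0%N ->
    E j.+1 <= (1 - 7 / (8 * alpha)) * E j + 96 * alpha * q * E 0%N.
  move=> jt /ball jb; have [xi xj /(_ jb) n] := xS j jt.
  have := precond_step mu0 a1 As Hs (Hmu xt) AH HA xi th0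
    (fun u => gradient_approx fC2 mu0 th0 Hmu grad_xs close u jb).
  rewrite -/eta addrAC -xj // => h.
  have tri : wnorm A (x j - xt) <= wnorm A (x j - xs) + wnorm A (xt - xs).
    have -> : x j - xt = (x j - xs) - (xt - xs) by rewrite opprB addrA subrK.
    exact: wnormB.
  apply: (@step_sqr _ alpha q _ (l2norm xi / Num.sqrt mu) _
    (wnorm A (x j - xt) ^+ 2)) => //; first exact: wnorm_ge0.
    rewrite expr_div_n (sqr_sqrtr (ltW mu0)) ler_pdivrMr //.
    by rewrite (le_trans n) // mulrA mulrAC.
  apply: (@le_trans _ _ ((wnorm A (x j - xs) + wnorm A (xt - xs)) ^+ 2)).
    by rewrite ler_sqr ?nnegrE ?addr_ge0 ?wnorm_ge0.
  rewrite E0E -subr_ge0.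
  move: (wnorm A (x j - xs)) (wnorm A (xt - xs)) => a b.
  have -> : 2 * (a ^+ 2 + b ^+ 2) - (a + b) ^+ 2 = (a - b) ^+ 2 by ring.
  exact: sqr_ge0.
have [Et1 Et2] := recursion_bound a1 q0 aq Epos step (leqnn t).
have xtb : wnorm A (xt - xs) <= wnorm A (xt - xs) by [].
have /andP[_ v1] := value_bounds fC2 mu0 Hmu grad_xs close (ball _ Et1).
have /andP[v2 _] := value_bounds fC2 mu0 Hmu grad_xs close xtb.
apply: (ratio_bound a1 q0 t0 (Epos 0%N) (Epos t) v1 _ _ Et2).
  by rewrite E0E.
rewrite E0E => /eqP; rewrite sqrf_eq0 => /eqP n0.
have /andP[v3 v4] := value_bounds fC2 mu0 Hmu grad_xs close xtb.
by apply/eqP; move: v3 v4; rewrite n0 expr0n /= !mulr0 eq_le => -> ->.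
Qed.

End Iterates.

(** * Smooth convex components *)

Section Component.
Context {R : realType} {d : nat}.
Implicit Types (u v x y : 'cV[R]_d) (psi f : 'cV[R]_d -> R) (lambda : R).

(** Only small positive [h] are constrained: since the derivative is known to exist, its right-hand
    quotients determine it. *)
Lemma derive_le_of_quadratic (phi : R -> R) (D G K : R) : is_derive (0 : R) 1 phi D ->
  (forall h, 0 < h < 1 -> phi h - phi 0 <= h * G + K * h ^+ 2) -> D <= G.
Proof.
move=> [dphi <-] H; rewrite leNgt; apply/negP => GD.
pose e := ('D_1 phi 0 - G) / 2.
have e0 : 0 < e by rewrite divr_gt0 // subr_gt0.
have /cvgrPdist_lt/(_ e e0) : (fun h => h^-1 *: ((phi \o shift 0) (h *: 1) - phi 0)) @ 0^'
  --> 'D_1 phi 0 by [].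
rewrite /dnbhs /= => /nbhs_normP[r /= r0 Hr].
pose K' := `|K| + 1.
have K'0 : 0 < K' by rewrite ltr_wpDl.
pose h := Num.min (r / 2) (Num.min (1 / 2) (e / K')).
have h0 : 0 < h by rewrite !lt_min; apply/and3P; split; rewrite divr_gt0.
have hr : h <= r / 2 by rewrite ge_min lexx.
have h1 : h <= 1 / 2 by rewrite !ge_min lexx orbT.
have hK : K * h <= e.
  have : h <= e / K' by rewrite !ge_min lexx !orbT.
  rewrite ler_pdivlMr // => /(le_trans _); apply.
  rewrite mulrC ler_pM2l // (le_trans (ler_norm K)) // lerDl //.
have hb : `|0 - h| < r by rewrite sub0r normrN gtr0_norm //; lra.
have hn : h != 0 by rewrite gt_eqF.
have := Hr h hb hn; rewrite /= [h *: 1]mulr1 addr0 => /ltr_normlP[_].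
have : 0 < h < 1 by rewrite h0 /=; lra.
move=> /H hH h3.
have {hH} h2 : h^-1 *: (phi h - phi 0) <= G + K * h.
  rewrite [_ *: _]/(_ * _) ler_pdivrMl //.
  by have -> : h * (G + K * h) = h * G + K * h ^+ 2 by ring.
have eE : 2 * e = 'D_1 phi 0 - G by rewrite /e mulrCA mulfV ?mulr1.
by clearbody e; lra.
Qed.

Section ConvexSmooth.
Variables (psi : 'cV[R]_d -> R) (lambda : R).
Hypotheses (lambda0 : 0 < lambda).
Hypotheses (cvx : convex_function [set: 'cV[R]_d] psi) (smo : smooth lambda psi).

Lemma convex_gradient_ineq x y : psi x + dot (gradient psi x) (y - x) <= psi y.
Proof.
have D := is_derive_line (t := 0) (x := x) (v := y - x) (proj1 smo _).
rewrite line0 in D.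
suff : dot (gradient psi x) (y - x) <= psi y - psi x by rewrite lerBrDl.
apply: (@derive_le_of_quadratic _ _ _ 0 D) => h /andP[h0 h1].
rewrite mul0r addr0 line0.
have := cvx (Itv01 (ltW h0) (ltW h1)) (mem_setT y) (mem_setT x).
move=> H; have {H} : psi (h *: y + (1 - h) *: x) <= h * psi y + (1 - h) * psi x := H.
have -> : h *: y + (1 - h) *: x = x + h *: (y - x).
  by rewrite scalerBl scale1r scalerBr addrC -addrA; congr (_ + _); rewrite addrC.
by move: (psi (x + _)) (psi x) (psi y) => a b c; lra.
Qed.

(** Subtract from [psi] its tangent at [y]. The result is minimal at [y], while smoothness makes a
    gradient step of length 1 / lambda from [x] to [z] decrease it by |g|^2 / (2 lambda). *)
Lemma cocoercive x y : l2norm (gradient psi x - gradient psi y) ^+ 2 <=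
  2 * lambda * (psi x - psi y - dot (gradient psi y) (x - y)).
Proof.
set g := gradient psi x - gradient psi y.
pose z := x - lambda^-1 *: g.
have h1 := convex_gradient_ineq y z.
have h2 := proj2 smo z x.
have zx : z - x = - (lambda^-1 *: g) by rewrite /z addrC addKr.
have zy : z - y = (x - y) - lambda^-1 *: g by rewrite /z addrAC.
move: h1 h2; rewrite zx zy l2normN dotNr (dotBr _ (x - y)) !dotZr l2norm_sqr dotZl dotZr -l2norm_sqr.
have gg : l2norm g ^+ 2 = dot (gradient psi x) g - dot (gradient psi y) g.
  by rewrite l2norm_sqr {1}/g dotBl.
move: gg; move: (l2norm g ^+ 2) (dot (gradient psi x) g) (dot (gradient psi y) g)
  (dot (gradient psi y) (x - y)) (psi x) (psi y) (psi z) => n a b p q r s gg h1 h2.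
have l1 : lambda^-1 * lambda = 1 by rewrite mulVf // gt_eqF.
have l0 : 0 < lambda^-1 by rewrite invr_gt0.
have h3 : lambda / 2 * (lambda^-1 * (lambda^-1 * n)) = lambda^-1 * n / 2.
  by field; rewrite gt_eqF.
rewrite h3 in h2.
have h4 : lambda^-1 * n / 2 <= q - r - p.
  have : lambda^-1 * n = lambda^-1 * a - lambda^-1 * b by rewrite gg mulrBr.
  by move: h1 h2; lra.
have -> : n = 2 * lambda * (lambda^-1 * n / 2) by field; rewrite gt_eqF.
by rewrite ler_pM2l // mulr_gt0.
Qed.

Lemma gradient_lipschitz x y :
  l2norm (gradient psi x - gradient psi y) <= lambda * l2norm (x - y).
Proof.
rewrite -ler_sqr ?nnegrE ?mulr_ge0 ?l2norm_ge0 ?(ltW lambda0) //.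
apply: le_trans (cocoercive x y) _.
have := proj2 smo x y.
move: (psi x) (psi y) (dot _ _) (l2norm (x - y)) => a b c n h.
have -> : (lambda * n) ^+ 2 = 2 * lambda * (lambda / 2 * n ^+ 2) by field.
by rewrite ler_pM2l ?mulr_gt0 //; lra.
Qed.

Lemma component_taylor x v :
  `|psi (x + v) - psi x - dot (gradient psi x) v| <= lambda / 2 * dot v v.
Proof.
have := convex_gradient_ineq x (x + v); have := proj2 smo (x + v) x.
rewrite (addrC x) addrK l2norm_sqr.
move: (psi (v + x)) (psi x) (dot _ v) (dot v v) => a b c n h1 h2.
have n0 : 0 <= lambda / 2 * n by lra.
by apply/ler_normlP; split; lra.
Qed.

End ConvexSmooth.
End Component.

(** * A Bernstein inequality for vectors, conditional on the past *)

Section Cosh.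
Context {R : realType}.
Implicit Types (a b c l p y z : R).

Definition cosh z : R := (expR z + expR (- z)) / 2.
Definition sinh z : R := (expR z - expR (- z)) / 2.

(** In the induction step the defect is l (1 - l) (y - z) (y^n - z^n), whose last two factors have
    the same sign. *)
Lemma exprn_convex l y z n : 0 <= l <= 1 -> 0 <= y -> 0 <= z ->
  (l * y + (1 - l) * z) ^+ n <= l * y ^+ n + (1 - l) * z ^+ n.
Proof.
move=> /andP[l0 l1] y0 z0; elim: n => [|n IH]; first by rewrite !expr0; lra.
have l1' : 0 <= 1 - l by lra.
have c0 : 0 <= l * y + (1 - l) * z by rewrite addr_ge0 // mulr_ge0.
rewrite exprS (le_trans (ler_wpM2l c0 IH)) // -subr_ge0 !exprS.
have -> : l * (y * y ^+ n) + (1 - l) * (z * z ^+ n)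
    - (l * y + (1 - l) * z) * (l * y ^+ n + (1 - l) * z ^+ n)
  = l * (1 - l) * ((y - z) * (y ^+ n - z ^+ n)) by ring.
apply: mulr_ge0; first exact: mulr_ge0.
have [yz|zy] := leP y z.
  by rewrite mulr_le0 // subr_le0 // lerXn2r ?nnegrE.
by rewrite mulr_ge0 // subr_ge0 ?lerXn2r ?nnegrE // ltW.
Qed.

Lemma cosh_series z :
  (fun n => \sum_(0 <= k < n) (exp_coeff z k + exp_coeff (- z) k) / 2) @ \oo --> cosh z.
Proof.
have h := cvgD (is_cvg_series_exp_coeff z) (is_cvg_series_exp_coeff (- z)).
have {}h := cvgMr_tmp (b := 2^-1) (h _).
rewrite (_ : (fun n => _) =
  fun n => (series (exp_coeff z) + series (exp_coeff (- z))) n * 2^-1); first exact: h.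
by apply/funext => n; rewrite /series /= !fctE -big_split /= big_distrl.
Qed.

Lemma exp_coeff_sym z k : (exp_coeff z k + exp_coeff (- z) k) / 2 =
  if odd k then 0 else (z ^+ 2) ^+ k./2 / k`!%:R.
Proof.
rewrite /exp_coeff /= exprNn -signr_odd -exprM mul2n.
case: ifP => ok; first by rewrite expr1 mulN1r mulNr addrN mul0r.
rewrite expr0 mul1r even_halfK ?ok //.
by rewrite mulrDl -splitr.
Qed.

(* [cosh \o sqrt] is convex, being a power series with nonnegative coefficients. *)
Lemma cosh_sqrt_convex l y z c : 0 <= l <= 1 ->
  c ^+ 2 = l * y ^+ 2 + (1 - l) * z ^+ 2 ->
  cosh c <= l * cosh y + (1 - l) * cosh z.
Proof.
move=> l01 cE; have /andP[l0 l1] := l01.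
have hy := cvgMl_tmp (a := l) (@cosh_series y).
have hz := cvgMl_tmp (a := 1 - l) (@cosh_series z).
apply: (ler_cvg_to (@cosh_series c) (cvgD (hy _) (hz _))).
apply: nearW => n; rewrite !fctE !mulr_sumr -big_split /=.
apply: ler_sum => k _; rewrite !exp_coeff_sym.
case: ifP => _; first by rewrite !mulr0 addr0.
rewrite !mulrA -mulrDl ler_wpM2r ?invr_ge0 ?ler0n // cE.
by rewrite exprn_convex // sqr_ge0.
Qed.

Lemma coshD y z : cosh (y + z) = cosh y * cosh z + sinh y * sinh z.
Proof. by rewrite /cosh /sinh opprD !expRD; field. Qed.

Lemma coshB y z : cosh (y - z) = cosh y * cosh z - sinh y * sinh z.
Proof. by rewrite coshD /cosh /sinh opprK; field. Qed.

Lemma cosh_gt0 z : 0 < cosh z.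
Proof. by rewrite divr_gt0 // addr_gt0 // expR_gt0. Qed.

Lemma norm_sinh_le z : `|sinh z| <= cosh z.
Proof.
have := expR_gt0 z; have := expR_gt0 (- z); rewrite /sinh /cosh => h1 h2.
by apply/ler_normlP; split; lra.
Qed.

(** The tangent inequality is used at -b/2, then squared and inverted; at -b it would only give 1 /
    (1 - b), which is too large. The range keeps 1 - 3 b + b^2 nonnegative. *)
Lemma expR_le2 b : 0 <= b <= 1 / 3 -> expR b <= 1 + b + b ^+ 2.
Proof.
move=> /andP[b0 b3].
have h := expR_ge1Dx (- (b / 2)).
have E : expR b = (expR (- (b / 2)) ^+ 2)^-1.
  by rewrite -expRM_natl -expRN; congr expR; field.
have h0 : 0 < 1 + - (b / 2) by lra.
have h2 : (1 + - (b / 2)) ^+ 2 <= expR (- (b / 2)) ^+ 2.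
  by rewrite ler_sqr ?nnegrE ?expR_ge0 // ltW.
have h3 : 0 < (1 + - (b / 2)) ^+ 2 by rewrite exprn_gt0.
rewrite E (le_trans (_ : _ <= ((1 + - (b / 2)) ^+ 2)^-1)) //.
  by rewrite lef_pV2 ?posrE // exprn_gt0 // expR_gt0.
rewrite -[leLHS]mul1r ler_pdivrMr //.
have -> : (1 + b + b ^+ 2) * (1 + - (b / 2)) ^+ 2 =
  1 + b ^+ 2 / 4 * (1 - 3 * b + b ^+ 2) by field.
by rewrite lerDl mulr_ge0 ?divr_ge0 ?sqr_ge0 //; have := sqr_ge0 b; lra.
Qed.

Lemma expRN_le2 b : 0 <= b -> expR (- b) <= 1 - b + b ^+ 2.
Proof.
move=> b0; have h := expR_ge1Dx b.
have h0 : 0 < 1 + b by lra.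
rewrite expRN (le_trans (_ : _ <= (1 + b)^-1)) //.
  by rewrite lef_pV2 ?posrE ?expR_gt0.
rewrite -[leLHS]mul1r ler_pdivrMr //.
have -> : (1 - b + b ^+ 2) * (1 + b) = 1 + b ^+ 3 by ring.
by rewrite lerDl exprn_ge0.
Qed.

(** With [a], [b], [c] the lengths of [s], [x], [s + x] and [p] their inner product, c^2 is the
    average of (a + b)^2 and (a - b)^2 with weights (1 + t) / 2 and (1 - t) / 2. Convexity and the
    addition formulas leave a term linear in [p], which will have mean zero. *)
Lemma cosh_step a b c p : 0 <= a -> 0 <= b <= 1 / 3 -> `|p| <= a * b ->
  c ^+ 2 = a ^+ 2 + 2 * p + b ^+ 2 ->
  cosh c <= cosh a * (1 + 2 * b ^+ 2) + sinh a / a * p.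
Proof.
move=> a0 b3 pab cE; have /andP[b0 b13] := b3.
have e1 := expR_le2 b3; have e2 := expRN_le2 b0.
have e3 := expR_ge1Dx b; have e4 := expR_ge1Dx (- b).
have ch0 := cosh_gt0 a.
have chb : cosh b <= 1 + b ^+ 2 by rewrite /cosh; lra.
have shb : `|sinh b - b| <= b ^+ 2 / 2.
  by apply/ler_normlP; rewrite /sinh; split; lra.
have bb : 0 <= b ^+ 2 by rewrite sqr_ge0.
(* The weight [t] is undefined here; [p] vanishes, so the value of [sinh a / a] at 0 does not
   matter. *)
have [ab0|abn0] := eqVneq (a * b) 0.
  have p0 : p = 0 by apply/eqP; rewrite -normr_le0 -ab0.
  have c2 : c ^+ 2 = 1 * (a + b) ^+ 2 + (1 - 1) * 0 ^+ 2.
    have -> : 1 * (a + b) ^+ 2 + (1 - 1) * 0 ^+ 2 = a ^+ 2 + 2 * (a * b) + b ^+ 2 by ring.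
    by rewrite cE p0 ab0.
  rewrite p0 mulr0 addr0; apply: le_trans (cosh_sqrt_convex _ c2) _.
    by rewrite ler01 lexx.
  rewrite mul1r subrr mul0r addr0 coshD.
  have -> : sinh a * sinh b = 0.
    move/eqP: ab0; rewrite mulf_eq0 => /orP[] /eqP ->;
    by rewrite /sinh oppr0 subrr mul0r ?mulr0 ?mul0r.
  rewrite addr0 ler_pM2l //; lra.
have an0 : a != 0 by apply: contra abn0 => /eqP ->; rewrite mul0r.
have bn0 : b != 0 by apply: contra abn0 => /eqP ->; rewrite mulr0.
have ab : 0 < a * b by rewrite lt0r abn0 mulr_ge0.
pose t := p / (a * b).
have t1 : `|t| <= 1.
  by rewrite normrM normfV (gtr0_norm ab) ler_pdivrMr // mul1r.
have /ler_normlP[t2 t3] := t1.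
have c2 : c ^+ 2 = (1 + t) / 2 * (a + b) ^+ 2 + (1 - (1 + t) / 2) * (a - b) ^+ 2.
  by rewrite cE /t; field; rewrite ?an0 ?bn0.
have l01 : 0 <= (1 + t) / 2 <= 1 by apply/andP; split; lra.
apply: le_trans (cosh_sqrt_convex l01 c2) _.
rewrite coshD coshB.
have -> : (1 + t) / 2 * (cosh a * cosh b + sinh a * sinh b) +
  (1 - (1 + t) / 2) * (cosh a * cosh b - sinh a * sinh b) =
  cosh a * cosh b + sinh a / a * p + t * sinh a * (sinh b - b).
  by rewrite /t; field; rewrite ?an0 ?bn0.
have h1 : cosh a * cosh b <= cosh a * (1 + b ^+ 2) by rewrite ler_pM2l.
have h2 : t * sinh a * (sinh b - b) <= cosh a * (b ^+ 2 / 2).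
  have u1 : `|t * sinh a| <= cosh a.
    rewrite normrM -(mul1r (cosh a)).
    by apply: ler_pM => //; exact: norm_sinh_le.
  by apply: le_trans (ler_norm _) _; rewrite normrM; exact: ler_pM.
have h3 : 0 <= cosh a * b ^+ 2 by rewrite mulr_ge0 // ltW.
lra.
Qed.

Lemma cosh_l2normD d (s x : 'cV[R]_d) : l2norm x <= 1 / 3 ->
  cosh (l2norm (s + x)) <= cosh (l2norm s) * (1 + 2 * dot x x)
    + sinh (l2norm s) / l2norm s * dot s x.
Proof.
move=> x3; rewrite -l2norm_sqr; apply: cosh_step.
- exact: l2norm_ge0.
- by rewrite l2norm_ge0.
- exact: norm_dot.
- by rewrite !l2norm_sqr dotDl !dotDr (dotC x s); ring.
Qed.

Lemma expR_le_cosh z : expR z <= 2 * cosh z.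
Proof. by have := expR_ge0 (- z); rewrite /cosh; lra. Qed.

End Cosh.

(** * Independence of a fresh sample from the past *)

Section Independence.
Context {R : realType}.

Lemma indep_integral (dO d1 d2 : measure_display) (Omega : measurableType dO)
    (T1 : measurableType d1) (T2 : measurableType d2)
    (P : probability Omega R) (Q : probability T2 R)
    (Y : {mfun Omega >-> T1}) (Z : {mfun Omega >-> T2}) (Phi : T1 * T2 -> \bar R) :
  (forall A B, measurable A -> measurable B ->
    P (Y @^-1` A `&` Z @^-1` B) = (P (Y @^-1` A) * Q B)%E) ->
  measurable_fun [set: T1 * T2] Phi -> (forall p, 0 <= Phi p)%E ->
  (\int[P]_w Phi (Y w, Z w) = \int[P]_w \int[Q]_s Phi (Y w, s))%E.
Proof.
move=> indep mPhi Phi0.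
have mX : measurable_fun [set: Omega] (fun w => (Y w, Z w)).
  by apply/measurable_fun_pairP; split; exact: measurable_funPT.
pose X : {mfun Omega >-> (T1 * T2)%type} :=
  HB.pack (fun w => (Y w, Z w)) (isMeasurableFun.Build _ _ _ _ _ mX).
have E A : measurable A -> (distribution P Y \x Q)%E A = distribution P X A.
  apply: product_measure_unique => B C mB mC.
  exact: indep.
have -> : (\int[P]_w Phi (Y w, Z w) = \int[distribution P X]_p Phi p)%E.
  by rewrite ge0_integral_distribution.
rewrite (eq_measure_integral (distribution P Y \x Q)%E); last first.
  by move=> A mA _; exact/esym/E.
rewrite fubini_tonelli1 //.
rewrite (@ge0_integral_distribution _ _ _ _ _ P Y) //.
  exact: measurable_fun_fubini_tonelli_F.
by move=> y; apply: integral_ge0.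
Qed.

Section History.
Context (dO dX : measure_display) (Omega : measurableType dO) (Xi : measurableType dX).
Context (P : probability Omega R) (K : finType) (X : K -> {RV P >-> Xi}).
Implicit Types J : {set K}.

Definition cylinders J : set (set Omega) :=
  [set C | exists2 A : K -> set Xi, (forall i, measurable (A i)) &
    C = \bigcap_(i in [set` J]) (X i @^-1` A i)].

(** The past as a type: [Omega] with the sigma-algebra generated by the samples indexed by [J].
    Being determined by the past becomes ordinary measurability on this type. *)
Definition history J := g_sigma_algebraType (cylinders J).

Lemma cylinders_measurable J : cylinders J `<=` measurable.
Proof.
move=> C [A mA ->]; apply: fin_bigcap_measurable => // i _.
by rewrite -[X in measurable X]setTI; exact: measurable_funPT.
Qed.

Lemma measurable_history J (A : set Omega) : (<<s cylinders J >>) A -> measurable A.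
Proof.
apply: smallest_sub; last exact: cylinders_measurable.
exact: sigma_algebra_measurable.
Qed.

Lemma measurable_fun_history J : measurable_fun [set: Omega] (id : Omega -> history J).
Proof. by move=> _ A mA; rewrite setTI; exact: (measurable_history mA). Qed.

Lemma measurable_fun_history_sub J J' : J \subset J' ->
  measurable_fun [set: history J'] (id : history J' -> history J).
Proof.
move=> /fintype.subsetP JJ'; apply: (@measurability _ _ (history J') (history J) setT id (cylinders J)) => //.
move=> _ [_ [A mA ->] <-]; rewrite setTI /=; apply: sub_sigma_algebra.
exists (fun i => if i \in J then A i else setT) => [i|].
  by case: ifP.
apply/seteqP; split => w /= h i iJ.
  by case: ifP => // iJ'; exact: h.
by have := h i (JJ' _ iJ); rewrite /= iJ.
Qed.

Lemma measurable_fun_history_coord J k : k \in J ->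
  measurable_fun [set: history J] (X k : history J -> Xi).
Proof.
move=> kJ _ B mB; rewrite setTI; apply: sub_sigma_algebra.
exists (fun i => if i == k then B else setT) => [i|]; first by case: ifP.
apply/seteqP; split => w /= h.
  by move=> i _; case: eqP => [->|].
by have := h k kJ; rewrite /= eqxx.
Qed.

(** For fixed [B] both sides are finite measures in [A], so it suffices to compare them on the
    cylinders, which are stable under intersection. There the claim is mutual independence over [J]
    enlarged by [k]. *)
Lemma history_indep (D : probability Xi R) J k (A : set Omega) (B : set Xi) :
  iid D X -> k \notin J -> (<<s cylinders J >>) A -> measurable B ->
  P (A `&` X k @^-1` B) = (P A * D B)%E.
Proof.
move=> [indep ident] kJ mA mB.
have mXB : measurable (X k @^-1` B).
  by rewrite -[Y in measurable Y]setTI; exact: measurable_funPT.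
have DBfin : (0 <= fine (D B))%R by rewrite fine_ge0.
have DBE : D B = (fine (D B))%:E by rewrite fineK // fin_num_measure.
have XkD : P (X k @^-1` B) = D B by rewrite -(ident k B mB).
transitivity (mscale (NngNum DBfin) P A); last first.
  by rewrite /mscale /= -DBE muleC.
transitivity (mrestr P mXB A) => //.
have cT : cylinders J setT.
  exists (fun=> setT) => //; apply/seteqP; split => // w _ i _; exact: I.
apply: (@g_sigma_algebra_measure_unique _ _ _ (cylinders J) _ (fun=> setT)) => //.
- exact: cylinders_measurable.
- by apply: bigcup_const; exists 0%N.
- move=> _ _ [A1 mA1 ->] [A2 mA2 ->]; exists (fun i => A1 i `&` A2 i).
    by move=> i; exact: measurableI.
  apply/seteqP; split => w /=.
    by move=> [h1 h2] i iJ; split; [exact: h1|exact: h2].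
  by move=> h; split => i iJ; have [] := h i iJ.
- move=> _ [F mF ->].
  suff : P (\bigcap_(i in [set` J]) (X i @^-1` F i) `&` X k @^-1` B) =
    ((fine (D B))%:E * P (\bigcap_(i in [set` J]) (X i @^-1` F i)))%E by [].
  rewrite -DBE.
  pose F' i := if i == k then B else F i.
  have -> : \bigcap_(i in [set` J]) (X i @^-1` F i) `&` X k @^-1` B =
      \bigcap_(i in [set` (k |: J)%SET]) (X i @^-1` F' i).
    apply/seteqP; split => w /=.
      move=> [h1 h2] i /=; rewrite in_setU1 /F' => /orP[/eqP ->|iJ].
        by rewrite eqxx.
      by case: eqP => [->//|_]; exact: h1.
    move=> h; split=> [i iJ|].
      have := h i; rewrite /= in_setU1 iJ orbT /F' => /(_ isT).
      by case: eqP => // ik; move: kJ; rewrite -ik iJ.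
    by have := h k; rewrite /= setU11 /F' eqxx; exact.
  rewrite !indep //; last by move=> i; rewrite /F'; case: ifP.
  rewrite big_setU1 //= {1}/F' eqxx XkD; congr (_ * _)%E.
  apply: eq_bigr => i iJ; rewrite /F'; case: eqP => // ik.
  by move: kJ; rewrite -ik iJ.
- by move=> _; rewrite /mrestr (le_lt_trans (probability_le1 _ _)) ?ltry //; exact: measurableI.
Qed.

(** Conditioning in Tonelli form: the past enters as the identity map of [Omega], and the fresh
    sample is integrated out under its own law. *)
Lemma history_integral (D : probability Xi R) J k (Phi : history J * Xi -> \bar R) :
  iid D X -> k \notin J -> measurable_fun [set: history J * Xi] Phi ->
  (forall p, 0 <= Phi p)%E ->
  (\int[P]_w Phi (w, X k w) = \int[P]_w \int[D]_s Phi (w, s))%E.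
Proof.
move=> hiid kJ mPhi Phi0.
pose Y : {mfun Omega >-> history J} :=
  HB.pack (id : Omega -> history J) (isMeasurableFun.Build _ _ _ _ _ (@measurable_fun_history J)).
apply: (@indep_integral _ _ _ _ _ _ P D Y (X k)) => // A B mA mB.
exact: (history_indep hiid kJ mA mB).
Qed.

End History.
End Independence.

(** * Joint measurability in the sample and the iterate *)

Section JointMeasurability.
Context {R : realType} {d : nat} (dT : measure_display) (T : measurableType dT).
Implicit Types (x : T -> 'cV[R]_d).

Definition measurable_vec x := forall i, measurable_fun [set: T] (fun p => x p i 0).

Definition grid n (z : 'cV[R]_d) : 'cV[R]_d :=
  \col_i ((Num.floor (n.+1%:R * z i 0))%:~R / n.+1%:R).

Lemma cvg_grid (z : 'cV[R]_d) : grid n z @[n --> \oo] --> z.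
Proof.
apply/cvg_ballP => e e0.
have /cvgrPdist_lt/(_ e e0) := @cvg_harmonic R; apply: filterS => n /=.
rewrite sub0r normrN gtr0_norm ?invr_gt0 ?ltr0n // => ne.
split=> // i j; rewrite ord1 /ball /= mxE.
have n0 : (0 : R) < n.+1%:R by rewrite ltr0n.
have /andP[f1 f2] := floor_itv (n.+1%:R * z i 0).
set k := (Num.floor _)%:~R in f1 *.
have {}f2 : n.+1%:R * z i 0 < k + 1 by move: f2; rewrite intrD.
apply: le_lt_trans ne.
have -> : z i 0 - k / n.+1%:R = (n.+1%:R * z i 0 - k) / n.+1%:R.
  by rewrite mulrBl mulrAC mulfV ?mul1r // gt_eqF.
rewrite normrM (gtr0_norm (_ : 0 < n.+1%:R^-1)) ?invr_gt0 //.
apply: ler_piMl; first by rewrite invr_ge0 ler0n.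
by apply/ler_normlP; split; lra.
Qed.

(* Caratheodory functions are jointly measurable: round [x] to a grid, so that
   only countably many values of the second argument matter. *)
Lemma measurable_caratheodory (g : T -> 'cV[R]_d -> R) x :
  (forall z, measurable_fun [set: T] (g ^~ z)) -> (forall p, continuous (g p)) ->
  measurable_vec x -> measurable_fun [set: T] (fun p => g p (x p)).
Proof.
move=> mg cg mx.
apply: (@measurable_fun_cvg _ _ _ _ (fun n p => g p (grid n (x p)))); last first.
  move=> p _; apply: (@cvg_comp _ _ _ (fun n => grid n (x p)) (g p)); last exact: cg.
  exact: cvg_grid.
move=> n _ B mB; rewrite setTI.
pose node (k : 'cV[int]_d) : 'cV[R]_d := \col_i ((k i 0)%:~R / n.+1%:R).
pose cell (k : 'cV[int]_d) :=
  \bigcap_(i in [set: 'I_d]) ((fun p => n.+1%:R * x p i 0) @^-1`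
     `[(k i 0)%:~R, (k i 0 + 1)%:~R[%classic).
have -> : (fun p => g p (grid n (x p))) @^-1` B =
    \bigcup_(k : 'cV[int]_d) (cell k `&` (g ^~ (node k)) @^-1` B).
  apply/seteqP; split => p /=.
    move=> gB; exists (\col_i Num.floor (n.+1%:R * x p i 0)) => //; split.
      by move=> i _ /=; rewrite in_itv /= mxE; exact: floor_itv.
    rewrite /=; congr (B (g p _)) : gB.
    by apply/matrixP => i j; rewrite !mxE.
  move=> [k _ [ck gB]]; congr (B (g p _)) : gB.
  apply/matrixP => i j; rewrite !mxE.
  have := ck i I; rewrite /= in_itv /= => h.
  by rewrite (floor_def h).
apply: countable_bigcupT_measurable => [|k]; first exact: countableP.
apply: measurableI.
  apply: fin_bigcap_measurable => // i _.
  rewrite -[X in measurable X]setTI.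
  have mi : measurable_fun [set: T] (fun p => n.+1%:R * x p i 0).
    by apply: measurable_funM; [exact: measurable_cst|exact: mx].
  by apply: mi => //; exact: measurable_itv.
by rewrite -[X in measurable X]setTI; exact: mg.
Qed.

Lemma measurable_vecD x y : measurable_vec x -> measurable_vec y ->
  measurable_vec (fun p => x p + y p).
Proof.
move=> mx my i; rewrite (_ : (fun p => _) = (fun p => x p i 0 + y p i 0)).
  exact: measurable_funD.
by apply/funext => p; rewrite mxE.
Qed.

Lemma measurable_vec_cst (v : 'cV[R]_d) : measurable_vec (fun=> v).
Proof. by move=> i; exact: measurable_cst. Qed.

Lemma measurable_vecZ (a : T -> R) x : measurable_fun [set: T] a -> measurable_vec x ->
  measurable_vec (fun p => a p *: x p).
Proof.
move=> ma mx i; rewrite (_ : (fun p => _) = (fun p => a p * x p i 0)).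
  exact: measurable_funM.
by apply/funext => p; rewrite mxE.
Qed.

Lemma measurable_vecB x y : measurable_vec x -> measurable_vec y ->
  measurable_vec (fun p => x p - y p).
Proof.
move=> mx my; apply: measurable_vecD => // i.
rewrite (_ : (fun p => _) = (fun p => - (y p i 0))).
  exact: measurableT_comp.
by apply/funext => p; rewrite mxE.
Qed.

Lemma measurable_vec_sum (I : Type) (s : seq I) (F : I -> T -> 'cV[R]_d) :
  (forall k, measurable_vec (F k)) -> measurable_vec (fun p => \sum_(k <- s) F k p).
Proof.
move=> mF i; rewrite (_ : (fun p => _) = (fun p => \sum_(k <- s) F k p i 0)).
  by apply: measurable_sum => k; exact: mF.
by apply/funext => p; rewrite summxE.
Qed.

Lemma measurable_vec_mulmx (M : 'M[R]_d) x : measurable_vec x ->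
  measurable_vec (fun p => M *m x p).
Proof.
move=> mx i; rewrite (_ : (fun p => _) = (fun p => \sum_j M i j * x p j 0)).
  apply: measurable_sum => j; apply: measurable_funM; [exact: measurable_cst|exact: mx].
by apply/funext => p; rewrite mxE.
Qed.

Lemma measurable_dot x y : measurable_vec x -> measurable_vec y ->
  measurable_fun [set: T] (fun p => dot (x p) (y p)).
Proof.
move=> mx my; rewrite (_ : (fun p => _) = (fun p => \sum_i x p i 0 * y p i 0)).
  apply: measurable_sum => i; apply: measurable_funM; [exact: mx|exact: my].
by apply/funext => p; rewrite dotE.
Qed.

Lemma measurable_wnorm (M : 'M[R]_d) x : measurable_vec x ->
  measurable_fun [set: T] (fun p => wnorm M (x p)).
Proof.
move=> mx; apply: (@measurableT_comp _ _ _ _ _ _ (@Num.sqrt R)).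
  by apply: continuous_measurable_fun; exact: sqrt_continuous.
by apply: measurable_dot => //; exact: measurable_vec_mulmx.
Qed.

Lemma measurable_l2norm x : measurable_vec x ->
  measurable_fun [set: T] (fun p => l2norm (x p)).
Proof.
move=> mx; rewrite (_ : (fun p => _) = (fun p => wnorm 1%:M (x p))).
  exact: measurable_wnorm.
by apply/funext => p; rewrite l2normE.
Qed.

(** Partial derivatives are limits of difference quotients along 1 / (n + 1), and each quotient is a
    Caratheodory function evaluated at measurable points. *)
Lemma measurable_gradient (g : T -> 'cV[R]_d -> R) x :
  (forall z, measurable_fun [set: T] (g ^~ z)) ->
  (forall p z, differentiable (g p) z) ->
  measurable_vec x -> measurable_vec (fun p => gradient (g p) (x p)).
Proof.
move=> mg dg mx i.
have cg p : continuous (g p) by move=> z; exact: differentiable_continuous.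
pose e : 'cV[R]_d := delta_mx i 0.
apply: (@measurable_fun_cvg _ _ _ _ (fun n p =>
  (n.+1%:R^-1)^-1 * (g p (n.+1%:R^-1 *: e + x p) - g p (x p)))).
  move=> n; apply: measurable_funM; first exact: measurable_cst.
  apply: measurable_funB; last exact: measurable_caratheodory.
  apply: (measurable_caratheodory mg cg).
  by apply: measurable_vecD => //; exact: measurable_vec_cst.
move=> p _.
have -> : gradient (g p) (x p) i 0 = 'D_e (g p) (x p).
  by rewrite derive_gradient // dot_delta_mx.
have := diff_derivable (v := e) (dg p (x p)).
move=> /cvgr_dnbhsP; apply; split; first by move=> n; rewrite invr_eq0 pnatr_eq0.
exact: cvg_harmonic.
Qed.

End JointMeasurability.

Section BoundedIntegral.
Context {R : realType} (d : measure_display) (T : measurableType d) (D : probability T R).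
Implicit Types f g : T -> R.

Lemma bounded_integrable f (M : R) : measurable_fun [set: T] f ->
  (forall s, `|f s| <= M) -> D.-integrable [set: T] (EFin \o f).
Proof.
move=> mf fM; apply: measurable_bounded_integrable => //.
  by rewrite (le_lt_trans (probability_le1 _ _)) // ltry.
exists M; split; first by rewrite num_real.
by move=> x Mx s _; exact: le_trans (fM s) (ltW Mx).
Qed.

Lemma integrable_cst_prob (a : R) : D.-integrable [set: T] (EFin \o cst a).
Proof. by apply: (@bounded_integrable _ `|a|) => //; exact: measurable_cst. Qed.

Lemma integral_cst_prob (a : R) : (\int[D]_s a%:E = a%:E)%E.
Proof.
rewrite (integral_cst D measurableT a%:E).
by rewrite [X in (_ * X)%E](probability_setT D) mule1.
Qed.

Lemma integral_affine f g (a b c : R) :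
  D.-integrable [set: T] (EFin \o f) -> D.-integrable [set: T] (EFin \o g) ->
  (\int[D]_s (a + (b * f s + c * g s))%:E =
    a%:E + (b%:E * \int[D]_s (f s)%:E + c%:E * \int[D]_s (g s)%:E))%E.
Proof.
move=> iF iG.
have iA := integrable_cst_prob a.
have ibf := integrableZl measurableT b iF.
have icg := integrableZl measurableT c iG.
under eq_integral do rewrite EFinD EFinD !EFinM.
rewrite (integralD _ iA (integrableD _ ibf icg)) // (integralD _ ibf icg) //.
rewrite (integralZl _ iF) // (integralZl _ iG) //.
by rewrite integral_cst_prob.
Qed.

End BoundedIntegral.

Lemma measurable_cosh_l2norm {R : realType} {d : nat} dT (T : measurableType dT)
    (y : T -> 'cV[R]_d) :
  measurable_vec y -> measurable_fun [set: T] (fun p => cosh (l2norm (y p))).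
Proof.
move=> /measurable_l2norm my.
apply: measurable_funM; last exact: measurable_cst.
apply: measurable_funD; apply: (measurableT_comp (@measurable_expR R)) => //.
exact: measurableT_comp.
Qed.

Section Bernstein.
Context {R : realType} {d : nat} (dO dX : measure_display).
Context (Omega : measurableType dO) (Xi : measurableType dX).
Context (P : probability Omega R) (D : probability Xi R).
Context (K : finType) (X : K -> {RV P >-> Xi}).
Variables (J0 : {set K}) (u : Omega -> Xi -> 'cV[R]_d) (v : R).
Hypotheses (X_iid : iid D X) (v0 : 0 <= v).
Hypothesis meas_u : measurable_vec (fun p : history X J0 * Xi => u p.1 p.2).
Hypothesis u_small : forall w s, l2norm (u w s) <= 1 / 3.
Hypothesis u_mean : forall w y, (\int[D]_s (dot y (u w s))%:E = 0)%E.
Hypothesis u_var : forall w, (\int[D]_s (dot (u w s) (u w s))%:E <= v%:E)%E.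

Let S (ks : seq K) w := \sum_(k <- ks) u w (X k w).

Let mus w : measurable_vec (u w).
Proof.
move=> i; have := measurable_fun_pair2 (w : history X J0) (meas_u i).
exact.
Qed.

(** One fresh sample with the past [w] frozen: the linear term of [cosh_l2normD] integrates to zero,
    and the variance bound controls the rest. *)
Lemma cosh_step_integral w (y : 'cV[R]_d) :
  (\int[D]_s (cosh (l2norm (y + u w s)))%:E <= ((cosh (l2norm y)) * (1 + 2 * v))%:E)%E.
Proof.
set a := cosh (l2norm y); set kap := sinh (l2norm y) / l2norm y.
have mdot1 := measurable_dot (mus w) (mus w).
have mdot2 := measurable_dot (measurable_vec_cst y) (mus w).
have i1 : D.-integrable [set: Xi] (EFin \o (fun s => dot (u w s) (u w s))).
  apply: (@bounded_integrable _ _ _ _ _ 1) => // s.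
  rewrite ger0_norm ?dot_ge0 // -l2norm_sqr expr_le1 ?l2norm_ge0 //.
  by apply: le_trans (u_small w s) _; rewrite ler_pdivrMr // mul1r ler1n.
have i2 : D.-integrable [set: Xi] (EFin \o (fun s => dot y (u w s))).
  apply: (@bounded_integrable _ _ _ _ _ (l2norm y)) => // s.
  apply: le_trans (norm_dot _ _) _; apply: ler_piMr; first exact: l2norm_ge0.
  by apply: le_trans (u_small w s) _; rewrite ler_pdivrMr // mul1r ler1n.
apply: (@le_trans _ _ (\int[D]_s (a + ((2 * a) * dot (u w s) (u w s) + kap * dot y (u w s)))%:E)%E).
  have le s : cosh (l2norm (y + u w s)) <=
      a + ((2 * a) * dot (u w s) (u w s) + kap * dot y (u w s)).
    by apply: le_trans (cosh_l2normD _ (u_small w s)) _; rewrite -/a -/kap; lra.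
  apply: ge0_le_integral => //.
  - by move=> s _; rewrite lee_fin ltW // cosh_gt0.
  - apply/measurable_EFinP; apply: measurable_cosh_l2norm.
    by apply: measurable_vecD => //; exact: measurable_vec_cst.
  - apply/measurable_EFinP.
    exact: (measurable_funD (measurable_cst a) (measurable_funD
      (measurable_funM (measurable_cst (2 * a)) mdot1)
      (measurable_funM (measurable_cst kap) mdot2))).
  - by move=> s _; rewrite lee_fin.
rewrite (integral_affine _ _ _ i1 i2) u_mean mule0 adde0.
have a0 : 0 < a := cosh_gt0 _.
apply: (@le_trans _ _ (a%:E + (2 * a)%:E * v%:E)%E).
  by rewrite leeD2l // lee_wpmul2l // lee_fin mulr_ge0 // ltW.
by rewrite -EFinM -EFinD lee_fin; lra.
Qed.

Let after (ks : seq K) : {set K} := J0 :|: [set k | k \in ks].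

Let history_measurable_u (J : {set K}) dT (T : measurableType dT)
    (h : T -> history X J) (z : T -> Xi) : J0 \subset J ->
  measurable_fun [set: T] h -> measurable_fun [set: T] z ->
  measurable_vec (fun p => u (h p) (z p)).
Proof.
move=> JJ mh mz i.
have := measurableT_comp (measurable_fun_history_sub (X := X) JJ) mh => mh'.
exact: (measurableT_comp (meas_u i) (measurable_fun_pair mh' mz)).
Qed.

Let measurable_S (J : {set K}) ks dT (T : measurableType dT) (h : T -> history X J) :
  J0 \subset J -> {subset ks <= J} -> measurable_fun [set: T] h ->
  measurable_vec (fun p => S ks (h p)).
Proof.
move=> JJ ksJ mh; elim: ks ksJ => [|k ks IH] ksJ.
  rewrite (_ : (fun p => _) = fun=> 0); first exact: measurable_vec_cst.
  by apply/funext => p; rewrite /S big_nil.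
rewrite (_ : (fun p => _) = fun p => u (h p) (X k (h p)) + S ks (h p)); last first.
  by apply/funext => p; rewrite /S big_cons.
apply: measurable_vecD; last by apply: IH => l lks; rewrite ksJ // inE lks orbT.
apply: history_measurable_u => //.
have kJ : k \in J by rewrite ksJ // mem_head.
exact: (measurableT_comp (measurable_fun_history_coord (X := X) kJ) mh).
Qed.

Lemma measurable_sum_history ks : measurable_vec (fun w : Omega => S ks w).
Proof.
apply: (@measurable_S [set: K]%SET ks _ Omega (id : Omega -> history X [set: K]%SET)).
- exact: finset.subsetT.
- by move=> k _; rewrite inE.
- exact: measurable_fun_history.
Qed.

(* Pinelis' supermartingale: [cosh] of the norm of the partial sums grows by a
   factor at most [1 + 2 v] per sample. *)
Lemma cosh_sum_integral ks : uniq ks -> (forall k, k \in ks -> k \notin J0) ->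
  (\int[P]_w (cosh (l2norm (S ks w)))%:E <= ((1 + 2 * v) ^+ size ks)%:E)%E.
Proof.
have v2 : 0 <= 1 + 2 * v by rewrite addr_ge0 // mulr_ge0.
elim/last_ind: ks => [_ _|ks k IH].
  rewrite (eq_integral (fun=> 1%:E)); last first.
    by move=> w _; rewrite /S big_nil l2norm0 /cosh oppr0 expR0 -mulr2n -mulr_natr mul1r divff.
  by rewrite integral_cst_prob expr0.
rewrite rcons_uniq => /andP[kks uks] kJ0.
have IH' : forall l, l \in ks -> l \notin J0.
  by move=> l lks; apply: kJ0; rewrite mem_rcons inE lks orbT.
have {IH IH'}IH := IH uks IH'.
have kJ : k \notin after ks.
  by rewrite !inE negb_or kks andbT kJ0 // mem_rcons mem_head.
have JJ : J0 \subset after ks by exact: finset.subsetUl.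
have ksJ : {subset ks <= after ks} by move=> l lks; rewrite !inE lks orbT.
pose Phi (p : history X (after ks) * Xi) := (cosh (l2norm (S ks p.1 + u p.1 p.2)))%:E.
have mPhi : measurable_fun [set: history X (after ks) * Xi] Phi.
  apply/measurable_EFinP; apply: measurable_cosh_l2norm; apply: measurable_vecD.
    by apply: (measurable_S JJ ksJ); exact: measurable_fst.
  by apply: (history_measurable_u JJ); [exact: measurable_fst|exact: measurable_snd].
have Phi0 p : (0 <= Phi p)%E by rewrite lee_fin ltW // cosh_gt0.
have -> : (\int[P]_w (cosh (l2norm (S (rcons ks k) w)))%:E = \int[P]_w Phi (w, X k w))%E.
  by apply: eq_integral => w _; rewrite /Phi /S -cats1 big_cat /= big_cons big_nil addr0.
rewrite (history_integral X_iid kJ mPhi Phi0).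
have mS := measurable_cosh_l2norm (measurable_sum_history ks).
apply: (@le_trans _ _ (\int[P]_w ((1 + 2 * v)%:E * (cosh (l2norm (S ks w)))%:E))%E).
  apply: ge0_le_integral => //.
  - by move=> w _; apply: integral_ge0.
  - have := measurable_fun_fubini_tonelli_F (m2 := D) Phi mPhi Phi0.
    move=> /measurableT_comp; apply; exact: measurable_fun_history.
  - by apply: measurable_funeM; exact/measurable_EFinP.
  - move=> w _; rewrite /Phi /= -EFinM mulrC; exact: cosh_step_integral.
rewrite ge0_integralZl //; last 2 first.
- by apply/measurable_EFinP.
- by move=> w _; rewrite lee_fin ltW // cosh_gt0.
by rewrite size_rcons exprS EFinM lee_wpmul2l // lee_fin.
Qed.

(** Markov's inequality for cosh of the norm. The usual free exponential parameter is absent because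
    it is built into the scale of [u]. *)
Lemma bernstein_tail ks (r : R) : uniq ks -> (forall k, k \in ks -> k \notin J0) ->
  (P [set w | (r <= l2norm (S ks w))%R] <=
    (2 * expR (2 * v * (size ks)%:R - r))%:E)%E.
Proof.
move=> uks kJ0; set A := [set w | (_ <= _)%R].
have mn := measurable_l2norm (measurable_sum_history ks).
have mA : measurable A.
  rewrite (_ : A = (fun w => l2norm (S ks w)) @^-1` `[r, +oo[).
    by rewrite -[X in measurable X]setTI; apply: mn => //; exact: measurable_itv.
  by apply/seteqP; split => w; rewrite /A /= in_itv /= andbT.
have mS := measurable_cosh_l2norm (measurable_sum_history ks).
have h1 : ((expR r / 2)%:E * P A <= \int[P]_w (cosh (l2norm (S ks w)))%:E)%E.
  rewrite -integral_cst //.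
  apply: (@le_trans _ _ (\int[P]_(w in A) (cosh (l2norm (S ks w)))%:E)%E).
    apply: ge0_le_integral => //.
    - by move=> w _; rewrite lee_fin divr_ge0 // expR_ge0.
    - by apply: measurable_funTS; apply/measurable_EFinP.
    - move=> w rw; rewrite lee_fin ler_pdivrMr // mulrC.
      by apply: le_trans (expR_le_cosh _); rewrite ler_expR.
  apply: ge0_subset_integral => //; first exact/measurable_EFinP.
  by move=> w _; rewrite lee_fin ltW // cosh_gt0.
have {h1}h2 := le_trans h1 (cosh_sum_integral uks kJ0).
have Pfin : P A = (fine (P A))%:E by rewrite fineK // fin_num_measure.
move: h2; rewrite Pfin -EFinM !lee_fin => h2.
have h3 : (1 + 2 * v) ^+ size ks <= expR (2 * v * (size ks)%:R).
  rewrite expRM_natr lerXn2r ?nnegrE ?expR_ge0 ?addr_ge0 ?mulr_ge0 //.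
  exact: expR_ge1Dx.
rewrite expRB mulrA ler_pdivlMr ?expR_gt0 //.
have {}h2 := le_trans h2 h3.
by move: h2; move: (fine _) (expR r) (expR _) => a b c h; lra.
Qed.

End Bernstein.

(** * The mini-batch noise *)

Section GradientExpectation.
Context {R : realType} {d : nat} (dX : measure_display) (Xi : measurableType dX).
Context (D : probability Xi R) (psi : Xi -> 'cV[R]_d -> R) (f : 'cV[R]_d -> R) (lambda : R).
Hypothesis int_psi : forall z, D.-integrable [set: Xi] (fun s => (psi s z)%:E).
Hypothesis mean_psi : forall z, (\int[D]_s (psi s z)%:E = (f z)%:E)%E.
Hypothesis cvx : forall s, convex_function [set: 'cV[R]_d] (psi s).
Hypothesis smo : forall s, smooth lambda (psi s).
Hypothesis lambda0 : 0 < lambda.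
Hypothesis df : forall z, differentiable f z.
Implicit Types y z : 'cV[R]_d.

Let dot_sub_sub y z : dot (y - z) (y - z) = dot z z + (1 * dot y y + (-2) * dot z y).
Proof. by rewrite dotBl !dotBr (dotC y z); ring. Qed.

Lemma measurable_component z : measurable_fun [set: Xi] (psi ^~ z).
Proof. by have /integrableP[/measurable_EFinP] := int_psi z. Qed.

Lemma measurable_component_gradient z : measurable_vec (fun s => gradient (psi s) z).
Proof.
apply: (measurable_gradient measurable_component); last exact: measurable_vec_cst.
by move=> s w; exact: (proj1 (smo s) w).
Qed.

(** The directional derivative differs from an increment of [psi] by at most a constant, so
    integrability of the values is enough. *)
Lemma integrable_dot_gradient y z :
  D.-integrable [set: Xi] (EFin \o (fun s => dot y (gradient (psi s) z))).
Proof.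
have mg := measurable_dot (measurable_vec_cst y) (measurable_component_gradient z).
pose g s : R := `|psi s (z + y)| + `|psi s z| + lambda / 2 * dot y y.
have ig : D.-integrable [set: Xi] (EFin \o g).
  have i1 := integrable_abse (int_psi (z + y)); have i2 := integrable_abse (int_psi z).
  have i3 := integrable_cst_prob D (lambda / 2 * dot y y).
  exact: (integrableD measurableT (integrableD measurableT i1 i2) i3).
apply: (le_integrable measurableT _ _ ig); first exact/measurable_EFinP.
move=> s _; rewrite /= lee_fin.
have c0 : 0 <= lambda / 2 * dot y y by rewrite mulr_ge0 ?dot_ge0 ?divr_ge0 ?(ltW lambda0).
rewrite [leRHS]ger0_norm ?addr_ge0 // (dotC y).
have := component_taylor (cvx s) (smo s) z y.
rewrite /g; move: (psi s (z + y)) (psi s z) (dot _ y) (lambda / 2 * _) => a b c e h.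
have -> : c = a - b - (a - b - c) by ring.
apply: le_trans (ler_normB _ _) _; apply: lerD => //.
exact: ler_normB.
Qed.

(** No differentiation under the integral: the integrated smoothness inequality bounds increments of
    [f] by a linear term with slope [E w] plus a quadratic one, whence one inequality. The direction
    [- y] gives the other. *)
Lemma integral_dot_gradient y z :
  (\int[D]_s (dot y (gradient (psi s) z))%:E = (dot y (gradient f z))%:E)%E.
Proof.
pose E w := fine (\int[D]_s (dot w (gradient (psi s) z))%:E)%E.
have EE w : (\int[D]_s (dot w (gradient (psi s) z))%:E = (E w)%:E)%E.
  by rewrite fineK //; exact: integrable_fin_num (integrable_dot_gradient w z).
have le w : dot w (gradient f z) <= E w.
  have Dl := is_derive_line (t := 0) (x := z) (v := w) (df _).
  rewrite line0 in Dl.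
  rewrite dotC; apply: (@derive_le_of_quadratic _ _ _ _ (lambda / 2 * dot w w) Dl).
  move=> h _; rewrite line0.
  have : (\int[D]_s (psi s (z + h *: w))%:E <=
    \int[D]_s (lambda / 2 * dot (h *: w) (h *: w)
      + (1 * psi s z + h * dot w (gradient (psi s) z)))%:E)%E.
    have i1 := integrable_cst_prob D (lambda / 2 * dot (h *: w) (h *: w)).
    have i2 := integrableD measurableT i1 (integrableD measurableT
        (integrableZl measurableT 1 (int_psi z))
        (integrableZl measurableT h (integrable_dot_gradient w z))).
    apply: (le_integral measurableT (int_psi _) i2) => s _; rewrite lee_fin.
    have := proj2 (smo s) (z + h *: w) z.
    rewrite (addrC z) addrK l2norm_sqr !dotZr dotZl (dotC _ w).
    by rewrite /cst; move: (psi s _) (psi s z) (dot w (gradient _ _)) (dot w w) => *; lra.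
  rewrite (integral_affine _ _ _ (int_psi z) (integrable_dot_gradient w z)).
  rewrite !mean_psi EE -!EFinM -!EFinD lee_fin dotZl dotZr.
  by move: (f _) (f z) (E w) (dot w w) => a b c e k; lra.
rewrite EE; congr (_%:E); apply/eqP; rewrite eq_le le andbT.
have := le (- y); rewrite dotNl.
have -> : E (- y) = - E y.
  apply: EFin_inj; rewrite EFinN -!EE.
  transitivity (\int[D]_s ((-1)%:E * (dot y (gradient (psi s) z))%:E))%E.
    by apply: eq_integral => s _; rewrite dotNl -EFinM mulN1r.
  by rewrite (integralZl _ (integrable_dot_gradient y z)) // EE -EFinM mulN1r.
by rewrite lerN2.
Qed.

Lemma gradient_mean_lipschitz y z :
  l2norm (gradient f y - gradient f z) <= lambda * l2norm (y - z).
Proof.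
set g := gradient f y - gradient f z.
have [->|gn0] := eqVneq (l2norm g) 0; first by rewrite mulr_ge0 ?l2norm_ge0 ?ltW.
have g0 : 0 < l2norm g by rewrite lt0r gn0 l2norm_ge0.
rewrite -(ler_pM2l g0) -expr2 l2norm_sqr {2}/g dotBr.
have i1 := integrable_dot_gradient g y; have i2 := integrable_dot_gradient g z.
rewrite -lee_fin.
have -> : (dot g (gradient f y) - dot g (gradient f z))%:E =
   (\int[D]_s (0 + (1 * dot g (gradient (psi s) y) + (-1) * dot g (gradient (psi s) z)))%:E)%E.
  by rewrite (integral_affine _ _ _ i1 i2) !integral_dot_gradient -!EFinM -!EFinD
     mul1r mulN1r add0r.
have i0 := integrable_cst_prob D 0.
have i3 := integrableD measurableT i0 (integrableD measurableT
  (integrableZl measurableT 1 i1) (integrableZl measurableT (-1) i2)).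
have i4 := integrable_cst_prob D (l2norm g * (lambda * l2norm (y - z))).
rewrite -(integral_cst_prob D); apply: (le_integral measurableT i3 i4) => s _; rewrite lee_fin add0r mul1r mulN1r -dotBr.
apply: le_trans (ler_norm _) _; apply: le_trans (norm_dot _ _) _.
by rewrite ler_pM2l // gradient_lipschitz.
Qed.

(* Co-coercivity of the component gradients turns the second moment of gradient
   differences into a Bregman divergence of [f]. *)
Lemma gradient_variance y z (G := fun s => gradient (psi s) y - gradient (psi s) z)
    (g := gradient f y - gradient f z) :
  (\int[D]_s (dot (G s - g) (G s - g))%:E <=
    (2 * lambda * (f y - f z - dot (gradient f z) (y - z)))%:E)%E.
Proof.
have mG : measurable_vec G.
  by apply: measurable_vecB; exact: measurable_component_gradient.
have i1 : D.-integrable [set: Xi] (EFin \o (fun s => dot (G s) (G s))).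
  apply: (@bounded_integrable _ _ _ _ _ ((lambda * l2norm (y - z)) ^+ 2)).
    exact: measurable_dot.
  move=> s; rewrite ger0_norm ?dot_ge0 // -l2norm_sqr.
  rewrite ler_sqr ?nnegrE ?mulr_ge0 ?l2norm_ge0 ?(ltW lambda0) //.
  exact: gradient_lipschitz.
have i2 : D.-integrable [set: Xi] (EFin \o (fun s => dot g (G s))).
  apply: (@bounded_integrable _ _ _ _ _ (l2norm g * (lambda * l2norm (y - z)))).
    by apply: measurable_dot => //; exact: measurable_vec_cst.
  move=> s; apply: le_trans (norm_dot _ _) _.
  by rewrite ler_wpM2l ?l2norm_ge0 // gradient_lipschitz.
have mean2 : (\int[D]_s (dot g (G s))%:E = (dot g g)%:E)%E.
  transitivity (\int[D]_s (0 + (1 * dot g (gradient (psi s) y)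
      + (-1) * dot g (gradient (psi s) z)))%:E)%E.
    by apply: eq_integral => s _; rewrite /G dotBr add0r mul1r mulN1r.
  rewrite (integral_affine _ _ _ (integrable_dot_gradient g y) (integrable_dot_gradient g z)).
  by rewrite !integral_dot_gradient -!EFinM -!EFinD mul1r mulN1r add0r {4}/g dotBr.
have -> : (\int[D]_s (dot (G s - g) (G s - g))%:E =
    \int[D]_s (dot g g + (1 * dot (G s) (G s) + (-2) * dot g (G s)))%:E)%E.
  by apply: eq_integral => s _; rewrite dot_sub_sub.
rewrite (integral_affine _ _ _ i1 i2) mean2 mul1e.
set c1 := 2 * lambda.
have ub : (\int[D]_s (dot (G s) (G s))%:E <=
    (c1 * (f y - f z - dot (gradient f z) (y - z)))%:E)%E.
  have i3 := integrable_dot_gradient (y - z) z.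
  have i4 : D.-integrable [set: Xi] (EFin \o (fun s => psi s y - psi s z)).
    exact: (integrableB measurableT (int_psi y) (int_psi z)).
  have mean4 : (\int[D]_s (psi s y - psi s z)%:E = (f y - f z)%:E)%E.
    under eq_integral do rewrite EFinB.
    by rewrite (integralB _ (int_psi y) (int_psi z)) // !mean_psi.
  have -> : (c1 * (f y - f z - dot (gradient f z) (y - z)))%:E =
    (\int[D]_s (0 + (c1 * (psi s y - psi s z) + (- c1) * dot (y - z) (gradient (psi s) z)))%:E)%E.
    rewrite (integral_affine _ _ _ i4 i3) mean4 integral_dot_gradient -!EFinM -!EFinD.
    by rewrite (dotC (y - z)); congr (_%:E); ring.
  apply: ge0_le_integral => //.
  - by move=> s _; rewrite lee_fin dot_ge0.
  - by apply/measurable_EFinP; exact: measurable_dot.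
  - apply/measurable_EFinP.
    exact: (measurable_funD (measurable_cst (0 : R)) (measurable_funD
      (measurable_funM (measurable_cst c1)
        (measurable_funB (measurable_component y) (measurable_component z)))
      (measurable_funM (measurable_cst (- c1))
        (measurable_dot (measurable_vec_cst (y - z)) (measurable_component_gradient z))))).
  move=> s _; rewrite lee_fin -l2norm_sqr.
  apply: le_trans (cocoercive lambda0 (cvx s) (smo s) y z) _.
  by rewrite (dotC (y - z)) -/c1; move: (psi s y) (psi s z) (dot _ _) => a b c; lra.
have fi : (\int[D]_s (dot (G s) (G s))%:E)%E \is a fin_num := integrable_fin_num measurableT i1.
move: ub; rewrite -(fineK fi) !lee_fin => ub.
have := dot_ge0 g; move: ub; move: (fine _) (dot g g) (c1 * _) => *; lra.
Qed.

End GradientExpectation.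

Section Noise.
Context {R : realType} {d : nat} (dO dX : measure_display).
Context (Omega : measurableType dO) (Xi : measurableType dX).
Context (P : probability Omega R) (D : probability Xi R).
Context (K : finType) (X : K -> {RV P >-> Xi}) (J0 : {set K}) (ks : seq K).
Variables (psi : Xi -> 'cV[R]_d -> R) (f : 'cV[R]_d -> R) (lambda mu l : R).
Variables (A : 'M[R]_d) (xs xt : 'cV[R]_d) (y : Omega -> 'cV[R]_d).
Hypothesis X_iid : iid D X.
Hypotheses (ks_uniq : uniq ks) (ks_new : forall k, k \in ks -> k \notin J0).
Hypothesis int_psi : forall z, D.-integrable [set: Xi] (fun s => (psi s z)%:E).
Hypothesis mean_psi : forall z, (\int[D]_s (psi s z)%:E = (f z)%:E)%E.
Hypothesis cvx : forall s, convex_function [set: 'cV[R]_d] (psi s).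
Hypothesis smo : forall s, smooth lambda (psi s).
Hypothesis df : forall z, differentiable f z.
Hypotheses (lambda0 : 0 < lambda) (mu0 : 0 < mu) (l0 : 0 < l).
Hypothesis my : measurable_vec (y : history X J0 -> 'cV[R]_d).
Hypothesis A_mu : forall v, mu * dot v v <= dot v (A *m v).
Hypothesis bregman : forall z, wnorm A (z - xs) <= wnorm A (xt - xs) ->
  f z - f xt - dot (gradient f xt) (z - xt) <= 5 / 9 * wnorm A (z - xt) ^+ 2.

Let m : R := (size ks)%:R.

Hypotheses (m0 : 0 < m) (batch : 60 * 50 * (l * lambda / (m * mu)) <= 1).

Let Good w := wnorm A (y w - xs) <= wnorm A (xt - xs).
Let N w := wnorm A (y w - xt).
Let Z w s := (gradient (psi s) (y w) - gradient (psi s) xt)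
  - (gradient f (y w) - gradient f xt).

(* [tau] balances the two terms of the exponent in [bernstein_tail]. Outside the
   basin, where no variance bound is available, the samples are discarded. *)
Let tau := Num.sqrt (9 * l / (20 * m * lambda)).
Let a w := if Good w then tau / N w else 0.
Let u w s := a w *: Z w s.

Let tau_sqr : tau ^+ 2 = 9 * l / (20 * m * lambda).
Proof. by rewrite sqr_sqrtr // divr_ge0 ?mulr_ge0 // ltW. Qed.

Let tau0 : 0 <= tau. Proof. exact: sqrtr_ge0. Qed.

Let N0 w : 0 <= N w. Proof. exact: wnorm_ge0. Qed.

Let a_ge0 w : 0 <= a w.
Proof. by rewrite /a; case: ifP => // _; rewrite divr_ge0. Qed.

Let aN w : a w * N w <= tau.
Proof.
rewrite /a; case: ifP => _; last by rewrite mul0r.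
have [->|n0] := eqVneq (N w) 0; first by rewrite mulr0.
by rewrite mulfVK.
Qed.

Let l2norm_le_N w : Num.sqrt mu * l2norm (y w - xt) <= N w.
Proof. by apply: sqrt_l2norm_le_wnorm; [exact: ltW|exact: A_mu]. Qed.

Let Z_le w s : l2norm (Z w s) <= 2 * lambda * l2norm (y w - xt).
Proof.
have h1 := gradient_lipschitz lambda0 (cvx s) (smo s) (y w) xt.
have h2 := gradient_mean_lipschitz int_psi mean_psi cvx smo lambda0 df (y w) xt.
apply: le_trans (l2normD _ _) _; rewrite l2normN.
by apply: le_trans (lerD h1 h2) _; rewrite -mulrA mulr_natl mulr2n.
Qed.

(** The batch size enters here. By strong convexity |y - xt| <= N / sqrt mu, so the squared sample
    norm is at most 4 lambda^2 tau^2 / mu, which is 9/5 of the ratio bounded in [batch]. *)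
Let u_small w s : l2norm (u w s) <= 1 / 3.
Proof.
have smu : 0 < Num.sqrt mu by rewrite sqrtr_gt0.
rewrite l2normZ ger0_norm // -(ler_pM2r smu).
have h1 : a w * l2norm (Z w s) * Num.sqrt mu <= 2 * lambda * tau.
  have h := ler_wpM2l (a_ge0 w) (Z_le w s).
  apply: le_trans (ler_wpM2r (ltW smu) h) _.
  have -> : a w * (2 * lambda * l2norm (y w - xt)) * Num.sqrt mu =
    2 * lambda * (a w * (Num.sqrt mu * l2norm (y w - xt))) by ring.
  rewrite ler_pM2l ?mulr_gt0 //; apply: le_trans (aN w).
  by rewrite ler_wpM2l.
apply: le_trans h1 _; rewrite -ler_sqr ?nnegrE ?mulr_ge0 ?divr_ge0 ?(ltW smu) ?(ltW lambda0) //.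
rewrite !exprMn tau_sqr (sqr_sqrtr (ltW mu0)).
have -> : 2 ^+ 2 * lambda ^+ 2 * (9 * l / (20 * m * lambda)) =
  9 / 5 * (l * lambda / (m * mu)) * mu by field; rewrite !gt_eqF.
by rewrite ler_pM2r //; move: batch; move: (l * lambda / _) => b h; lra.
Qed.

Let mZ (dT : measure_display) (T : measurableType dT) (h : T -> Omega) (z : T -> Xi) :
  measurable_vec (fun p => y (h p)) -> measurable_fun [set: T] z ->
  measurable_vec (fun p => Z (h p) (z p)).
Proof.
move=> mh mz.
have mp v : measurable_fun [set: T] (fun p => psi (z p) v).
  exact: (measurableT_comp (measurable_component int_psi v) mz).
have ds p v : differentiable (psi (z p)) v by exact: (proj1 (smo (z p)) v).
have mf v : measurable_fun [set: T] (fun p : T => f v) by exact: measurable_cst.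
apply: measurable_vecB; apply: measurable_vecB.
- exact: (measurable_gradient mp ds mh).
- exact: (measurable_gradient mp ds (measurable_vec_cst xt)).
- by apply: (measurable_gradient mf _ mh) => p v.
- exact: measurable_vec_cst.
Qed.

Let ma : measurable_fun [set: history X J0] (a : history X J0 -> R).
Proof.
have mN : measurable_fun [set: history X J0] (N : history X J0 -> R).
  by apply: measurable_wnorm; apply: measurable_vecB => //; exact: measurable_vec_cst.
apply: measurable_fun_ifT.
- apply: measurable_fun_ler; last exact: measurable_cst.
  by apply: measurable_wnorm; apply: measurable_vecB => //; exact: measurable_vec_cst.
(* Inversion is discontinuous at 0, but on nonnegative reals it is the power -1, which is
   measurable. *)
- rewrite (_ : (fun t => _) = fun t => tau * (N t) `^ (-1)); last first.
    by apply/funext => t; rewrite powR_inv1.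
  have mV := measurableT_comp (@measurable_powR R (-1)) mN.
  exact: (measurable_funM (measurable_cst tau) mV).
- exact: measurable_cst.
Qed.

Let mu_u : measurable_vec (fun p : history X J0 * Xi => u p.1 p.2).
Proof.
apply: (@measurable_vecZ _ _ _ _ (fun p : history X J0 * Xi => a p.1)).
  exact: (measurableT_comp ma measurable_fst).
apply: mZ; last exact: measurable_snd.
by move=> i; exact: (measurableT_comp (my i) measurable_fst).
Qed.

Let u_mean w v : (\int[D]_s (dot v (u w s))%:E = 0)%E.
Proof.
have ig z := integrable_dot_gradient int_psi cvx smo lambda0 (a w *: v) z.
pose c := dot (a w *: v) (gradient f (y w) - gradient f xt).
transitivity (\int[D]_s (- c + (1 * dot (a w *: v) (gradient (psi s) (y w))
    + (-1) * dot (a w *: v) (gradient (psi s) xt)))%:E)%E.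
  apply: eq_integral => s _; congr (_%:E).
  by rewrite /u /Z /c dotZr !dotZl !dotBr; ring.
rewrite (integral_affine _ _ _ (ig (y w)) (ig xt)).
have im := integral_dot_gradient int_psi mean_psi cvx smo lambda0 df (a w *: v).
rewrite !im -!EFinM -!EFinD; congr (_%:E).
by rewrite /c dotBr; ring.
Qed.

(** The chosen [tau] makes (10/9) lambda tau^2 equal to l / (2 m). Over m samples the exponent of
    [bernstein_tail] then grows by [l], and the threshold 3 l leaves -2 l. *)
Let u_var w : (\int[D]_s (dot (u w s) (u w s))%:E <= (l / (2 * m))%:E)%E.
Proof.
have v0 : 0 <= l / (2 * m) by rewrite divr_ge0 ?mulr_ge0 // ltW.
have var := gradient_variance int_psi mean_psi cvx smo lambda0 df (y w) xt.
have -> : (\int[D]_s (dot (u w s) (u w s))%:E =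
    (a w ^+ 2)%:E * \int[D]_s (dot (Z w s) (Z w s))%:E)%E.
  rewrite -ge0_integralZl //.
  - by apply: eq_integral => s _; rewrite /u dotZl dotZr mulrA -expr2 EFinM.
  - apply/measurable_EFinP.
    have mz : measurable_vec (Z w).
      by apply: mZ => //; exact: measurable_vec_cst.
    exact: measurable_dot.
  - by move=> s _; rewrite lee_fin dot_ge0.
  - by rewrite lee_fin sqr_ge0.
have [g|ng] := boolP (Good w); last by rewrite /a (negbTE ng) expr0n /= mul0e lee_fin.
have a2 : (0 <= (a w ^+ 2)%:E)%E by rewrite lee_fin sqr_ge0.
apply: le_trans (lee_wpmul2l a2 var) _; rewrite -EFinM lee_fin.
have h := bregman g; rewrite -/(N w) in h.
have l20 : 0 <= a w ^+ 2 * (2 * lambda) by rewrite mulr_ge0 ?sqr_ge0 ?mulr_ge0 ?(ltW lambda0).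
rewrite mulrA; apply: le_trans (ler_wpM2l l20 h) _.
have -> : a w ^+ 2 * (2 * lambda) * (5 / 9 * N w ^+ 2) =
  10 / 9 * lambda * (a w * N w) ^+ 2 by field.
have an2 : (a w * N w) ^+ 2 <= tau ^+ 2 by rewrite ler_sqr ?nnegrE ?mulr_ge0.
have c0 : 0 <= 10 / 9 * lambda by rewrite mulr_ge0 ?divr_ge0 ?(ltW lambda0).
apply: le_trans (ler_wpM2l c0 an2) _; rewrite tau_sqr.
have -> // : 10 / 9 * lambda * (9 * l / (20 * m * lambda)) = l / (2 * m).
by field; rewrite !gt_eqF.
Qed.

Definition noise w := m^-1 *: (\sum_(k <- ks) (gradient (psi (X k w)) (y w)
  - gradient (psi (X k w)) xt)) + gradient f xt - gradient f (y w).

Let noiseE w : m *: noise w = \sum_(k <- ks) Z w (X k w).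
Proof.
rewrite /noise /Z -addrA scalerDr scalerA mulfV ?gt_eqF // scale1r [in RHS]sumrB.
congr (_ + _).
by rewrite big_const_seq count_predT iter_addr_0 -scaler_nat -scalerN opprB.
Qed.

Lemma noise_eq0 w : y w = xt -> noise w = 0.
Proof.
move=> yw; have : m *: noise w = 0.
  by rewrite noiseE; apply: big1 => k _; rewrite /Z yw !subrr.
by move/eqP; rewrite scaler_eq0 gt_eqF //= => /eqP.
Qed.

Lemma measurable_noise : measurable_vec noise.
Proof.
have myO : measurable_vec (y : Omega -> 'cV[R]_d).
  by move=> i; exact: (measurableT_comp (my i) (@measurable_fun_history _ _ _ _ _ _ _ X J0)).
have mS : measurable_vec (fun w => \sum_(k <- ks) Z w (X k w)).
  by apply: measurable_vec_sum => k; apply: mZ => //; exact: measurable_funPT.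
rewrite (_ : noise = fun w => m^-1 *: (\sum_(k <- ks) Z w (X k w))).
  by apply: measurable_vecZ => //; exact: measurable_cst.
by apply/funext => w; rewrite -noiseE scalerA mulVf ?gt_eqF // scale1r.
Qed.

(** Membership in the ball is part of the event, since the noise is controlled only there. The
    strict inequality excludes an iterate equal to the snapshot, whose noise is zero. *)
Definition bad := [set w | Good w /\
  20 * (l * lambda / m) * wnorm A (y w - xt) ^+ 2 < l2norm (noise w) ^+ 2].

Lemma measurable_bad : measurable bad.
Proof.
have myO : measurable_vec (y : Omega -> 'cV[R]_d).
  by move=> i; exact: (measurableT_comp (my i) (@measurable_fun_history _ _ _ _ _ _ _ X J0)).
have mN (v : 'cV[R]_d) : measurable_fun [set: Omega] (fun w => wnorm A (y w - v)).
  by apply: measurable_wnorm; apply: measurable_vecB => //; exact: measurable_vec_cst.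
have m1 : measurable_fun [set: Omega] (fun w => wnorm A (y w - xs) <= wnorm A (xt - xs)).
  by apply: measurable_fun_ler => //; exact: measurable_cst.
have m2 : measurable_fun [set: Omega]
    (fun w => 20 * (l * lambda / m) * wnorm A (y w - xt) ^+ 2 < l2norm (noise w) ^+ 2).
  apply: measurable_fun_ltr.
    by apply: measurable_funM; [exact: measurable_cst|exact: measurable_funX].
  by apply: measurable_funX; apply: measurable_l2norm; exact: measurable_noise.
have := measurableI _ _ (m1 measurableT [set true] I) (m2 measurableT [set true] I).
by rewrite !setTI.
Qed.

Lemma bad_probability : (P bad <= (2 * expR (- (2 * l)))%:E)%E.
Proof.
have v0 : 0 <= l / (2 * m) by rewrite divr_ge0 ?mulr_ge0 // ltW.
have := bernstein_tail X_iid v0 mu_u u_small u_mean u_var (3 * l) ks_uniq ks_new.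
have -> : 2 * (l / (2 * m)) * (size ks)%:R - 3 * l = - (2 * l).
  by rewrite -/m; field; rewrite gt_eqF.
apply: le_trans; apply: le_measure; rewrite ?inE; first exact: measurable_bad.
  have mS := measurable_l2norm (measurable_sum_history mu_u ks).
  have m3 := measurable_fun_ler (measurable_cst (3 * l)) mS.
  by have := m3 measurableT [set true] I; rewrite setTI.
move=> w [g big] /=.
have n2 : 0 < l2norm (noise w) ^+ 2.
  apply: le_lt_trans big; rewrite !mulr_ge0 ?invr_ge0 ?exprn_ge0 ?wnorm_ge0 //; exact: ltW.
(* Dividing by [N w] is legitimate: if it vanished, the iterate would be the snapshot and its noise
   zero, against [n2]. *)
have Np : 0 < N w.
  rewrite lt0r N0 andbT; apply/eqP => Nw0.
  have yx : y w = xt.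
    apply/eqP; rewrite -subr_eq0; apply/eqP/l2norm_eq0/eqP.
    rewrite eq_le l2norm_ge0 andbT.
    have := l2norm_le_N w; rewrite Nw0.
    by rewrite pmulr_rle0 // sqrtr_gt0.
  by move: n2; rewrite (noise_eq0 yx) l2norm0 expr0n ltxx.
have -> : \sum_(k <- ks) u w (X k w) = (a w * m) *: noise w.
  by rewrite -scalerA noiseE scaler_sumr.
rewrite l2normZ ger0_norm ?mulr_ge0 ?(ltW m0) // -ler_sqr ?nnegrE ?mulr_ge0 ?l2norm_ge0 ?(ltW m0) ?(ltW l0) //.
have aw : a w = tau / N w by rewrite /a; move: g => ->.
have c0 : 0 < (tau / N w * m) ^+ 2.
  rewrite exprn_gt0 // !mulr_gt0 ?invr_gt0 // sqrtr_gt0 divr_gt0 // !mulr_gt0 //.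
rewrite [leRHS]exprMn aw; have := big; rewrite -(ltr_pM2l c0) => /ltW; apply: le_trans.
rewrite -/(N w) !exprMn exprVn tau_sqr.
have -> // : 9 * l / (20 * m * lambda) * (N w ^+ 2)^-1 * m ^+ 2 *
  (20 * (l * lambda / m) * N w ^+ 2) = 3 ^+ 2 * l ^+ 2.
by field; rewrite !gt_eqF // exprn_gt0.
Qed.

End Noise.

(** * The theorem *)

(** The error [th] = 1 / (72 alpha) at the minimizer is tripled by the change of center. In the
    self-concordant case it requires the radius th / 60, halved to 1 / (8640 alpha), and the
    hypothesis provides 1 / (12000 alpha). *)
Lemma basin_close (R : realType) (d : nat) (f : 'cV[R]_d -> R) (mu alpha : R)
    (xs xt y : 'cV[R]_d) :
  C2 f -> 0 < mu -> (forall x v, mu * dot v v <= dot v (hessian f x *m v)) -> 1 <= alpha ->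
  (exists L : R, [/\ 0 < L, lipschitz_hessian L f &
      nbhd_lipschitz f mu L xs (1 / (60 * 50 * alpha)) xt])
  \/ (self_concordant f /\ nbhd_self_concordant f xs (1 / (60 * 50 * alpha)) xt) ->
  wnorm (hessian f xt) (y - xs) <= wnorm (hessian f xt) (xt - xs) ->
  hessian_close f (1 / (24 * alpha)) xt y.
Proof.
move=> fC2 mu0 Hmu a1 near yb.
have al0 : 0 < alpha := lt_le_trans ltr01 a1.
have al0' : alpha != 0 by rewrite gt_eqF.
have ia0 : 0 < alpha^-1 by rewrite invr_gt0.
have ia1 : alpha^-1 <= 1 by rewrite invf_le1.
have psdH x : psd (hessian f x) := pd_psd mu0 (hessian_sym fC2 x) (Hmu x).
pose th := 1 / 72 * alpha^-1.
have th0 : 0 <= th by rewrite mulr_ge0 ?divr_ge0 ?(ltW ia0).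
have th3 : 0 <= th <= 1 / 3 by rewrite th0 /= /th; lra.
have -> : 1 / (24 * alpha) = 3 * th by rewrite /th; field.
have eE : 1 / (60 * 50 * alpha) <= th / 2.
  have -> : 1 / (60 * 50 * alpha) = 1 / (60 * 50) * alpha^-1 by field.
  by rewrite /th; lra.
case: near => [[L [L0 Lip nb]]|[sc nb]].
  have B0 : 0 <= mu `^ (3 / 2) / L by rewrite divr_ge0 ?powR_ge0 ?(ltW L0).
  apply: (hessian_close_recenter (r := th * (mu `^ (3 / 2) / L)) psdH th3 _ _ yb).
    by move=> z; exact: (lipschitz_hessian_close mu0 L0 (Hmu xs) Lip th0).
  apply: le_trans (ltW nb) _.
  by rewrite (mulrAC th) ler_wpM2r.
apply: (hessian_close_recenter (r := th / 60) psdH th3 _ _ yb).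
  move=> z zr v.
  have z100 : wnorm (hessian f xs) (z - xs) <= 1 / 100.
    by apply: le_trans zr _; move: th3 => /andP[]; rewrite /th; lra.
  apply: le_trans (self_concordant_close fC2 mu0 Hmu sc z100 v) _.
  rewrite ler_wpM2r //; first exact: (proj2 (psdH xs)).
  by rewrite mulrC -ler_pdivlMr.
apply: le_trans (ltW nb) _.
have -> : 1 / (60 * 50 * alpha) = 1 / (60 * 50) * alpha^-1 by field.
by rewrite /th; lra.
Qed.

Section Iterates.
Context {R : realType} {d : nat} (dO dX : measure_display).
Context (Omega : measurableType dO) (Xi : measurableType dX) (P : probability Omega R).
Variables (psi : Xi -> 'cV[R]_d -> R) (f : 'cV[R]_d -> R) (eta c : R).
Variables (xt : 'cV[R]_d) (H : 'M[R]_d) (t m : nat).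
Variables (xi : 'I_t -> 'I_m -> {RV P >-> Xi}) (x : nat -> Omega -> 'cV[R]_d).
Hypothesis mpsi : forall z, measurable_fun [set: Xi] (psi ^~ z).
Hypothesis dpsi : forall s z, differentiable (psi s) z.
Hypothesis x0 : forall w, x 0%N w = xt.
Hypothesis xS : forall (j : 'I_t) w,
  x j.+1 w = x j w - eta *: (invmx H *m
    (c *: (\sum_(i < m) (gradient (psi (xi j i w)) (x j w)
                          - gradient (psi (xi j i w)) xt)) + gradient f xt)).

Lemma measurable_iterate (dT : measure_display) (T : measurableType dT) (h : T -> Omega) n :
  (n <= t)%N ->
  (forall (j : 'I_t) i, (j < n)%N -> measurable_fun [set: T] (fun p => xi j i (h p))) ->
  measurable_vec (fun p => x n (h p)).
Proof.
elim: n => [_ _|n IH nt mh].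
  rewrite (_ : (fun p => _) = fun=> xt); first exact: measurable_vec_cst.
  by apply/funext => p; rewrite x0.
have mx : measurable_vec (fun p => x n (h p)).
  by apply: IH => [|j i jn]; [exact: ltnW|apply: mh; exact: ltnW].
pose j := Ordinal nt.
rewrite (_ : (fun p => _) = fun p => x n (h p) - eta *: (invmx H *m
    (c *: (\sum_(i < m) (gradient (psi (xi j i (h p))) (x n (h p))
                          - gradient (psi (xi j i (h p))) xt)) + gradient f xt))); last first.
  by apply/funext => p; rewrite -(xS j).
apply: measurable_vecB => //; apply: measurable_vecZ; first exact: measurable_cst.
apply: measurable_vec_mulmx; apply: measurable_vecD; last exact: measurable_vec_cst.
apply: measurable_vecZ; first exact: measurable_cst.
apply: measurable_vec_sum => i.
have mi : measurable_fun [set: T] (fun p => xi j i (h p)) by apply: mh.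
have mp z : measurable_fun [set: T] (fun p => psi (xi j i (h p)) z).
  exact: (measurableT_comp (mpsi z) mi).
have dp p z : differentiable (psi (xi j i (h p))) z by [].
apply: measurable_vecB.
  exact: (measurable_gradient mp dp mx).
exact: (measurable_gradient mp dp (measurable_vec_cst xt)).
Qed.

End Iterates.

Lemma union_bound (R : realType) (dO : measure_display) (Omega : measurableType dO)
    (P : probability Omega R) (t : nat) (B : 'I_t -> set Omega) (G : set Omega) (e : R) :
  (forall j, measurable (B j)) -> measurable G -> (forall j, P (B j) <= e%:E)%E ->
  (forall w, (forall j, ~ B j w) -> G w) -> ((1 - t%:R * e)%:E <= P G)%E.
Proof.
move=> mB mG PB BG.
have mU : measurable (\big[setU/set0]_(j < t) B j) by exact: bigsetU_measurable.
have PU : (P (\big[setU/set0]_(j < t) B j) <= (t%:R * e)%:E)%E.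
  have -> : (t%:R * e)%:E = (\sum_(j < t) e%:E)%E.
    by rewrite sumEFin sumr_const card_ord mulr_natl.
  apply: le_trans (_ : _ <= \sum_(j < t) P (B j))%E _; last by apply: lee_sum.
  pose B' n := if insub n is Some j then B j else set0.
  have E (j : 'I_t) : B' j = B j by rewrite /B' valK.
  under eq_bigr do rewrite -E; under [leRHS]eq_bigr do rewrite -E.
  apply: Boole_inequality => n _; rewrite /B'; case: insub => //.
have : (P (~` \big[setU/set0]_(j < t) B j) <= P G)%E.
  apply: le_measure; rewrite ?inE //; first exact: measurableC.
  move=> w nB; apply: BG => j Bj; apply: nB.
  by rewrite (bigD1 j) //=; left.
apply: le_trans; rewrite probability_setC //.
by rewrite EFinB leeB.
Qed.

Theorem theorem3 (R : realType) :
  exists c : R, 0 < c /\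
  forall (d : nat)
    (* the distribution of psi, as a family indexed by a probability space *)
    (dX : measure_display) (Xi : measurableType dX) (D : probability Xi R)
    (psi : Xi -> 'cV[R]_d -> R) (f : 'cV[R]_d -> R)
    (mu lambda : R) (xs : 'cV[R]_d)
    (alpha delta : R) (t m : nat)
    (xt : 'cV[R]_d) (H : 'M[R]_d)
    (dO : measure_display) (Omega : measurableType dO) (P : probability Omega R)
    (xi : 'I_t -> 'I_m -> {RV P >-> Xi})
    (x : nat -> Omega -> 'cV[R]_d),
  let kappa := lambda / mu in
  let eta := Num.min (Num.sqrt (2 / alpha)) 1 in
  (forall z, D.-integrable [set: Xi] (fun s => (psi s z)%:E)) ->
  (forall z, (f z)%:E = 'E_D[fun s => psi s z])%E ->
  (forall s, convex_function [set: 'cV[R]_d] (psi s)) ->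
  (forall s, smooth lambda (psi s)) ->
  0 < lambda ->
  0 < mu ->
  C2 f ->
  strongly_convex mu f ->
  minimizer f xs ->
  1 <= alpha ->
  0 < delta < 1 ->
  (1 <= t)%N ->
  (exists L : R, [/\ 0 < L, lipschitz_hessian L f &
      nbhd_lipschitz f mu L xs (1 / (c * alpha)) xt])
  \/ (self_concordant f /\ nbhd_self_concordant f xs (1 / (c * alpha)) xt) ->
  H^T = H ->
  loewner_le ((1 / Num.sqrt alpha) *: hessian f xt) H ->
  loewner_le H (Num.sqrt alpha *: hessian f xt) ->
  iid D (fun k : 'I_t * 'I_m => xi k.1 k.2) ->
  c * alpha ^+ 2 * kappa * ln (t%:R / delta) <= m%:R ->
  (forall w, x 0%N w = xt) ->
  (forall (j : 'I_t) w,
     x j.+1 w = x j w - eta *: (invmx H *m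
       (m%:R^-1 *: (\sum_(i < m) (gradient (psi (xi j i w)) (x j w)
                                  - gradient (psi (xi j i w)) xt))
        + gradient f xt))) ->
  ((1 - delta)%:E <=
    P [set w | (f (x t w) - f xs) / (f xt - f xs)
               <= (1 - 1 / (2 * alpha)) ^+ t
                  + c * alpha ^+ 2 * ln (t%:R / delta) * (kappa / m%:R)]%R)%E.
Proof.
(* The largest demands on the constant are 96 * 16 = 1536, from absorbing the noise in [step_sqr],
   and 8640 / 4 = 2160, from the self-concordant radius in [basin_close]. *)
exists (60 * 50); split; first by rewrite mulr_gt0.
move=> d dX Xi D psi f mu lambda xs alpha delta t m xt H dO Omega P xi x kappa eta.
move=> int_psi mean_psi cvx smo lambda0 mu0 fC2 sc fmin a1 /andP[delta0 delta1] t0.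
move=> near Hs AH HA xi_iid batch x0 xS.
have df z : differentiable f z by case: fC2.
have Hmu y v := strongly_convex_hessian fC2 y v sc.
have grad_xs := gradient_minimizer df fmin.
have {}mean_psi z : (\int[D]_s (psi s z)%:E = (f z)%:E)%E.
  by rewrite mean_psi unlock.
set A := hessian f xt in AH HA.
have psdA : psd A := pd_psd mu0 (hessian_sym fC2 xt) (Hmu xt).
have close y := basin_close (y := y) fC2 mu0 Hmu a1 near.
have al0 : 0 < alpha := lt_le_trans ltr01 a1.
have tR0 : 0 < t%:R :> R by rewrite ltr0n.
have tR1 : 1 <= t%:R :> R by rewrite ler1n.
pose l := ln (t%:R / delta).
have td0 : 0 < t%:R / delta by rewrite divr_gt0.
have l0 : 0 < l by rewrite ln_gt0 // ltr_pdivlMr // mul1r (lt_le_trans delta1).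
have exp_l : expR (- l) = delta / t%:R.
  by rewrite expRN lnK ?posrE // invf_div.
have kappa0 : 0 < kappa by rewrite divr_gt0.
have aa0 : 0 < alpha ^+ 2 by rewrite exprn_gt0.
have m0 : 0 < m%:R :> R.
  by apply: lt_le_trans batch; rewrite (mulr_gt0 _ l0) // (mulr_gt0 _ kappa0) // (mulr_gt0 _ aa0) // mulr_gt0.
pose q := l * (kappa / m%:R).
have q0 : 0 <= q := mulr_ge0 (ltW l0) (divr_ge0 (ltW kappa0) (ltW m0)).
have aq : 60 * 50 * alpha ^+ 2 * q <= 1.
  have -> : 60 * 50 * alpha ^+ 2 * q = 60 * 50 * alpha ^+ 2 * kappa * l / m%:R.
    by rewrite /q; field; rewrite gt_eqF.
  by rewrite ler_pdivrMr // mul1r.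
have q1 : 60 * 50 * q <= 1.
  apply: le_trans aq; rewrite (mulrAC _ (alpha ^+ 2)).
  by apply: ler_peMr; [rewrite mulr_ge0|exact: exprn_ege1].
have qE : l * lambda / m%:R = q * mu.
  by rewrite /q /kappa; field; rewrite !gt_eqF.
have th9 : (1 + 1 / (24 * alpha)) / 2 <= 5 / 9 :> R.
  have ia1 : alpha^-1 <= 1 by rewrite invf_le1.
  have -> : 1 / (24 * alpha) = 1 / 24 * alpha^-1 by field; rewrite gt_eqF.
  by lra.
have th0 : 0 <= 1 / (24 * alpha) by rewrite divr_ge0 ?mulr_ge0 // ltW.
have bregman z : wnorm A (z - xs) <= wnorm A (xt - xs) ->
    f z - f xt - dot (gradient f xt) (z - xt) <= 5 / 9 * wnorm A (z - xt) ^+ 2.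
  move=> zb; have h := bregman_bound fC2 mu0 Hmu close zb.
  apply: (le_trans h).
  by rewrite ler_wpM2r // sqr_ge0.
pose X (k : 'I_t * 'I_m) := xi k.1 k.2.
pose ks (j : 'I_t) := [seq (j, i) | i <- enum 'I_m].
(* The past of round [j] consists of all samples of earlier rounds. They determine [x j], and the
   batch [ks j] is disjoint from them. *)
pose J (j : 'I_t) : {set 'I_t * 'I_m} := [set k : 'I_t * 'I_m | (k.1 < j)%N]%SET.
have ks_uniq j : uniq (ks j) by rewrite map_inj_uniq ?enum_uniq // => i i' [].
have ks_new j k : k \in ks j -> k \notin J j.
  by move=> /mapP[i _ ->]; rewrite inE /= ltnn.
have ks_size j : size (ks j) = m by rewrite size_map size_enum_ord.
have mpsi := measurable_component int_psi.
have dpsi s z : differentiable (psi s) z by exact: (proj1 (smo s) z).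
have mx (j : 'I_t) : measurable_vec (x j : history X (J j) -> 'cV[R]_d).
  apply: (measurable_iterate (T := history X (J j)) (h := id) mpsi dpsi x0 xS).
    exact: ltnW.
  move=> j' i jj'; have kJ : (j', i) \in J j by rewrite inE.
  exact: (measurable_fun_history_coord (X := X) kJ).
pose nz (j : 'I_t) := noise X (ks j) psi f xt (x j).
pose B (j : 'I_t) := bad X (ks j) psi f lambda l A xs xt (x j).
have ks0 j : 0 < (size (ks j))%:R :> R by rewrite ks_size.
have mB j : measurable (B j).
  exact: (measurable_bad l A xs xt int_psi smo df (mx j) (ks0 j)).
have nzE j w : nz j w + gradient f (x j w) = m%:R^-1 *:
    (\sum_(i < m) (gradient (psi (xi j i w)) (x j w) - gradient (psi (xi j i w)) xt))
    + gradient f xt.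
  by rewrite /nz /noise subrK ks_size big_map big_enum.
have PB j : (P (B j) <= (delta / t%:R)%:E)%E.
  have [j0|jn0] := eqVneq (j : nat) 0%N.
    rewrite (_ : B j = set0) ?measure0 ?lee_fin ?divr_ge0 ?(ltW delta0) //.
    apply/seteqP; split => // w [_].
    have xj : x j w = xt by rewrite j0 x0.
    rewrite (noise_eq0 X psi f (ks0 j) xj) l2norm0 xj subrr wnorm0 expr0n /= mulr0.
    by rewrite ltxx.
  have t2 : (2 <= t)%N by rewrite (leq_trans _ (ltn_ord j)) // ltnS lt0n.
  have batch' : 60 * 50 * (l * lambda / ((size (ks j))%:R * mu)) <= 1.
    rewrite ks_size; apply: le_trans q1; rewrite ler_pM2l ?mulr_gt0 //.
    by rewrite invfM mulrA qE mulfK // gt_eqF.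
  apply: le_trans (bad_probability xi_iid (ks_uniq j) (@ks_new j) int_psi mean_psi cvx smo
    df lambda0 mu0 l0 (mx j) (Hmu xt) bregman (ks0 j) batch') _.
  have -> : expR (- (2 * l)) = (delta / t%:R) ^+ 2 by rewrite -exp_l -expRM_natl mulrN.
  have t2R : 2 <= t%:R :> R by rewrite ler_nat.
  rewrite lee_fin expr2 mulrA ler_piMl //; first by rewrite divr_ge0 // ltW.
  by rewrite mulrA ler_pdivrMr // mul1r; lra.
pose G := [set w | (f (x t w) - f xs) / (f xt - f xs)
  <= (1 - 1 / (2 * alpha)) ^+ t + 60 * 50 * alpha ^+ 2 * l * (kappa / m%:R)].
have mG : measurable G.
  have mxt : measurable_vec (x t).
    by apply: (measurable_iterate (h := id) mpsi dpsi x0 xS).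
  have mf z : measurable_fun [set: Omega] (fun _ : Omega => f z).
    exact: measurable_cst.
  have cf (w : Omega) : continuous f by move=> z; exact: differentiable_continuous.
  have mfx := measurable_caratheodory mf cf mxt.
  have mr := measurable_funM (measurable_funB mfx (measurable_cst (f xs)))
    (measurable_cst (f xt - f xs)^-1).
  have ml := measurable_fun_ler mr (measurable_cst ((1 - 1 / (2 * alpha)) ^+ t
    + 60 * 50 * alpha ^+ 2 * l * (kappa / m%:R))).
  by have := ml measurableT [set true] I; rewrite setTI.
(* The [t] bad events of probability at most [delta / t] add up to [delta]; what remains is the
   deterministic statement for one outcome outside them. *)
have := union_bound mB mG PB; rewrite mulrCA divff ?gt_eqF // mulr1; apply.
move=> w good; rewrite /G /= -(mulrA _ l) -/q.
apply: (@iterates_ratio _ _ f mu alpha q xs xt H (fun j => x j w) t) => //.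
move=> j jt; pose jo := Ordinal jt.
exists (nz jo w); first by rewrite nzE -(xS jo).
move=> gj; rewrite -qE leNgt; apply/negP => big.
by apply: (good jo); split => //; rewrite ks_size.
Qed.
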